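(* Let $\mathcal G=(V,E,W)$ be a finite connected weighted graph, let $U\subset V$ be non-empty and indistinguishable from outside, and let $\mathcal G'=(V',E',W')$ be the reduced graph. Let $G'$ be the random Green matrix of the $H^{2|2}$-model on $\mathcal G'$. Then, conditionally on $G'$, one can sample the Green matrix of the $H^{2|2}$-model on $\mathcal G$ by injecting independent random variables: on a suitable extension of the probability space there are a random element $\xi$ independent of $G'$ and a measurable map $\Phi$ such that $G=\Phi(G',\xi)$ has the law of the Green matrix of the $H^{2|2}$-model on $\mathcal G$ and $G'$ is almost surely the coarse-graining of $G$. Furthermore, this can be done in such a way that $G(k,\ell)=G'(k,\ell)$ for all $k,\ell\in V\setminus U$.
   Context: A finite weighted graph $\mathcal G=(V,E,W)$ is a simple, unoriented, finite connected graph with edge weights $W_{ij}=W_{ji}>0$ for $\{i,j\}\in E$, and $W_{ij}=0$ if $\{i,j\}$ is not an edge; $W_{ii}=0$. For $\beta\in\mathbb R^V$, $H_\beta$ is the symmetric matrix indexed by $V$ with $H_\beta(i,i)=2\beta_i$ and $H_\beta(i,j)=-W_{ij}$ for $i\ne j$. The law of the random potential of the $H^{2|2}$-model on $\mathcal G$ is the probability measure on $\mathbb R^V$ $$\nu^{W}(d\beta)=\Big(\sqrt{\tfrac{2}{\pi}}\Big)^{|V|}\mathbf 1_{\{H_\beta>0\}}\,e^{-\frac12\langle 1,H_\beta 1\rangle}\frac{1}{\sqrt{\det H_\beta}}\prod_{i\in V}d\beta_i,$$ where $H_\beta>0$ means positive definite and $1$ is the all-ones vector. The Green matrix of the $H^{2|2}$-model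 on $\mathcal G$ is the random matrix $G=H_\beta^{-1}$ with $\beta\sim\nu^W$. A subset $U\subset V$ is indistinguishable from outside if $W_{ki}=W_{kj}$ for all $i,j\in U$ and $k\notin U$. Reduced graph: $V'=(V\setminus U)\cup\{u\}$ with $u$ a new vertex; $W'_{k,\ell}=W_{k,\ell}$ for $k,\ell\neq u$, $W'_{k,u}=W'_{u,k}=\sum_{i\in U}W_{k,i}$ for $k\ne u$, $W'_{u,u}=0$. The coarse-graining of a symmetric matrix $G$ indexed by $V$ is the symmetric matrix indexed by $V'$ with entries $G(k,\ell)$ for $k,\ell\in V\setminus U$; $\frac1{|U|}\sum_{i\in U}G(k,i)$ at $(k,u)$ for $k\in V\setminus U$; and $\frac1{|U|^2}\sum_{i,j\in U}G(i,j)$ at $(u,u)$. *)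

(* Defs.v *)
From HB Require Import structures.
From mathcomp Require Import all_boot all_order all_algebra.
From mathcomp Require Import all_classical all_reals all_analysis.

Set Implicit Arguments.
Unset Strict Implicit.
Unset Printing Implicit Defensive.

Import Order.TTheory GRing.Theory Num.Theory.
Import numFieldNormedType.Exports.

Local Open Scope classical_set_scope.
Local Open Scope ring_scope.

Definition measure_ffun_display : measure_display -> measure_display.
Proof. exact. Qed.

Section measurable_ffun.
Context {d} {T : measurableType d} {I : finType}.

Definition g_sigma_ffun : set (set {ffun I -> T}) :=
  <<s \bigcup_(i in [set: I])
        preimage_set_system setT (fun f : {ffun I -> T} => f i) measurable >>.

Let ffun_set0 : g_sigma_ffun set0.
Proof. exact: sigma_algebra0. Qed.

Let ffun_setC A : g_sigma_ffun A -> g_sigma_ffun (~` A).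
Proof. by move=> sA; rewrite -setTD; apply: sigma_algebraCD. Qed.

Let ffun_bigcup (F : _^nat) : (forall i, g_sigma_ffun (F i)) ->
  g_sigma_ffun (\bigcup_i (F i)).
Proof. exact: sigma_algebra_bigcup. Qed.

HB.instance Definition _ := isPointed.Build {ffun I -> T} [ffun=> point].

HB.instance Definition _ := @isMeasurable.Build (measure_ffun_display d)
  {ffun I -> T} g_sigma_ffun ffun_set0 ffun_setC ffun_bigcup.

End measurable_ffun.

Lemma measurable_ffunP d d' (S : measurableType d) (T : measurableType d')
    (I : finType) (h : S -> {ffun I -> T}) :
  (forall i, measurable_fun setT (fun x => h x i)) -> measurable_fun setT h.
Proof.
move=> mh; apply: (@measurability _ _ _ _ _ _ (\bigcup_(i in [set: I])
  preimage_set_system setT (fun f : {ffun I -> T} => f i) measurable)) => //.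
move=> _ [_ [i _ [B mB <-]]] <-; rewrite !setTI.
by have := mh i measurableT B mB; rewrite setTI.
Qed.

Lemma pushforward_sigma_additive d d' (S : measurableType d)
    (T : measurableType d') (R : realType) (mu : {measure set S -> \bar R})
    (f : S -> T) :
  measurable_fun setT f -> semi_sigma_additive (pushforward mu f).
Proof.
move=> mf F mF tF mUF; rewrite /pushforward preimage_bigcup.
apply: measure_semi_sigma_additive.
- by move=> k; rewrite -[X in measurable X]setTI; exact: mf.
- apply/trivIsetP => /= i j _ _ ij; rewrite -preimage_setI.
  by move/trivIsetP : tF => /(_ _ _ _ _ ij) ->//; rewrite preimage_set0.
- by rewrite -preimage_bigcup -[X in measurable X]setTI; exact: mf.
Qed.

Section lebesgue_tuple.
Local Open Scope ereal_scope.
Variable R : realType.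
Local Notation tupleR n := (n.-tuple (measurableTypeR R)).

Section lebesgue_cons.
Variables (n : nat) (mu : {sigma_finite_measure set (tupleR n) -> \bar R}).

Let cons_pair (p : measurableTypeR R * tupleR n) : tupleR n.+1 :=
  [tuple of p.1 :: p.2].

Let mcons_pair : measurable_fun setT cons_pair.
Proof. exact: measurable_cons. Qed.

Definition lebesgue_cons : set (tupleR n.+1) -> \bar R :=
  pushforward (@lebesgue_measure R \x mu) cons_pair.

Let lebesgue_cons0 : lebesgue_cons set0 = 0.
Proof. by rewrite /lebesgue_cons /pushforward preimage_set0 measure0. Qed.

Let lebesgue_cons_ge0 A : 0 <= lebesgue_cons A.
Proof. exact: measure_ge0. Qed.

Let lebesgue_cons_sigma_additive : semi_sigma_additive lebesgue_cons.
Proof.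
by apply: pushforward_sigma_additive; exact: mcons_pair.
Qed.

HB.instance Definition _ := isMeasure.Build _ _ _ lebesgue_cons
  lebesgue_cons0 lebesgue_cons_ge0 lebesgue_cons_sigma_additive.

(* The sigma-finite instance of [\x] is hidden by the one for probabilities. *)
Let lebesgue_cons_sigma_finite : sigma_finite setT lebesgue_cons.
Proof.
have /sigma_finiteP[F [TF ndF Foo]] := sigma_finiteT (@lebesgue_measure R).
have /sigma_finiteP[G [TG ndG Goo]] := sigma_finiteT mu.
pose uncons (t : tupleR n.+1) : measurableTypeR R * tupleR n :=
  (thead t, [tuple of behead t]).
have consK : cancel cons_pair uncons.
  by move=> [x t]; congr pair; apply: val_inj.
have muncons : measurable_fun setT uncons.
  apply/measurable_fun_pairP; split; last exact: measurable_behead.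
  exact: (@measurable_tnth _ (measurableTypeR R) n.+1 ord0).
exists (fun i => uncons @^-1` (F i `*` G i)).
  rewrite -preimage_bigcup (_ : \bigcup_i (F i `*` G i) = setT)//.
  rewrite -setXTT TF TG predeqE => -[x y]; split.
    by move=> [k _ []/= ? ?]; split; exists k.
  move=> [/= [k _ Fkx] [l _ Gly]]; exists (maxn k l) => //; split.
  - by move: x Fkx; exact/subsetPset/ndF/leq_maxl.
  - by move: y Gly; exact/subsetPset/ndG/leq_maxr.
move=> i; have [mF Fi] := Foo i; have [mG Gi] := Goo i; split.
  by rewrite -[X in measurable X]setTI; apply: muncons => //; exact: measurableX.
rewrite /lebesgue_cons /pushforward -comp_preimage.
rewrite (_ : uncons \o cons_pair = id); last first.
  by apply/funext => p /=; rewrite consK.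
by rewrite preimage_id product_measure1E// lte_mul_pinfty// ge0_fin_numE.
Qed.

HB.instance Definition _ := Measure_isSigmaFinite.Build _ _ _ lebesgue_cons
  lebesgue_cons_sigma_finite.

End lebesgue_cons.

Fixpoint lebesgue_tuple n : {sigma_finite_measure set (tupleR n) -> \bar R} :=
  if n is n'.+1 then lebesgue_cons (lebesgue_tuple n')
  else \d_([tuple] : tupleR 0).

End lebesgue_tuple.

Section lebesgue_ffun.
Variables (R : realType) (I : finType).

(* R^I is identified with R^#|I| through the enumeration of I. *)
Let ffun_of_tuple (t : #|I|.-tuple (measurableTypeR R)) : {ffun I -> R} :=
  [ffun i => tnth t (enum_rank i)].

Let mffun_of_tuple : measurable_fun setT ffun_of_tuple.
Proof.
apply: measurable_ffunP => i.
rewrite [X in measurable_fun _ X](_ : _ = fun t => tnth t (enum_rank i)).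
  exact: measurable_tnth.
by apply/funext => t; rewrite ffunE.
Qed.

Definition lebesgue_ffun : set {ffun I -> R} -> \bar R :=
  pushforward (lebesgue_tuple R #|I|) ffun_of_tuple.

Let lebesgue_ffun0 : lebesgue_ffun set0 = 0%E.
Proof. by rewrite /lebesgue_ffun /pushforward preimage_set0 measure0. Qed.

Let lebesgue_ffun_ge0 A : (0 <= lebesgue_ffun A)%E.
Proof. exact: measure_ge0. Qed.

Let lebesgue_ffun_sigma_additive : semi_sigma_additive lebesgue_ffun.
Proof. by apply: pushforward_sigma_additive; exact: mffun_of_tuple. Qed.

HB.instance Definition _ := isMeasure.Build _ _ _ lebesgue_ffun
  lebesgue_ffun0 lebesgue_ffun_ge0 lebesgue_ffun_sigma_additive.

End lebesgue_ffun.

Definition has_law d d' (Omega : measurableType d) (T : measurableType d')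
    (R : realType) (P : probability Omega R) (X : Omega -> T)
    (mu : set T -> \bar R) : Prop :=
  measurable_fun setT X /\
  forall A, measurable A -> pushforward P X A = mu A.

Definition independent_rv d d1 d2 (Omega : measurableType d)
    (T1 : measurableType d1) (T2 : measurableType d2) (R : realType)
    (P : probability Omega R) (X : Omega -> T1) (Y : Omega -> T2) : Prop :=
  forall A B, measurable A -> measurable B ->
    P (X @^-1` A `&` Y @^-1` B) = (P (X @^-1` A) * P (Y @^-1` B))%E.

(* Random variables [X] on [Omega] are transported to [Omega'] as [X \o p]. *)
Definition space_extension d d' (Omega : measurableType d)
    (Omega' : measurableType d') (R : realType) (P : probability Omega R)
    (P' : probability Omega' R) (p : Omega' -> Omega) : Prop :=
  has_law P' p P.

Section model.
Variables (R : realType) (V : finType).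
Implicit Types (W : V -> V -> R) (beta : {ffun V -> R}).

Definition edge W : rel V := fun i j => 0 < W i j.

Record weighted_graph W : Prop := WeightedGraph {
  weight_sym : forall i j, W i j = W j i;
  weight_ge0 : forall i j, 0 <= W i j;
  weight_diag : forall i, W i i = 0;
  weight_connected : forall i j, connect (edge W) i j }.

(* V-indexed matrices as library matrices, through the enumeration of V; the
   determinant, and the inverse read back by [enum_rank], do not depend on it. *)
Definition mx_of (A : V -> V -> R) : 'M[R]_#|V| :=
  \matrix_(i, j) A (enum_val i) (enum_val j).

Definition Hmat W beta : V -> V -> R :=
  fun i j => if i == j then 2 * beta i else - W i j.

Definition posdef (A : V -> V -> R) : Prop :=
  forall x : V -> R, (exists i, x i != 0) ->
    0 < \sum_i \sum_j x i * A i j * x j.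

(* The double sum is <1, H_beta 1>. *)
Definition potential_density W beta : R :=
  if `[< posdef (Hmat W beta) >] then
    Num.sqrt (2 / pi) ^+ #|V| *
    expR (- (1 / 2) * \sum_i \sum_j Hmat W beta i j) *
    (Num.sqrt (\det (mx_of (Hmat W beta))))^-1
  else 0.

Definition potential_law W : set {ffun V -> R} -> \bar R :=
  fun A => (\int[@lebesgue_ffun R V]_(beta in A) (potential_density W beta)%:E)%E.

Definition green W beta : {ffun V * V -> R} :=
  [ffun p => invmx (mx_of (Hmat W beta)) (enum_rank p.1) (enum_rank p.2)].

Definition green_law W : set {ffun V * V -> R} -> \bar R :=
  pushforward (potential_law W) (green W).

End model.

Section reduction.
Variables (R : realType) (V : finType).
Implicit Types (W : V -> V -> R) (U : {set V}).

Definition indistinguishable W U : Prop :=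
  forall i j k, i \in U -> j \in U -> k \notin U -> W k i = W k j.

(* [None] is the new vertex. *)
Definition reduced_vertex U := option {k : V | k \notin U}.

Definition reduced_weight W U (a b : reduced_vertex U) : R :=
  match a, b with
  | Some k, Some l => W (val k) (val l)
  | Some k, None | None, Some k => \sum_(i in U) W (val k) i
  | None, None => 0
  end.

Definition coarse_graining U (G : {ffun V * V -> R}) :
    {ffun reduced_vertex U * reduced_vertex U -> R} :=
  [ffun p : reduced_vertex U * reduced_vertex U =>
    match p with
    | (Some k, Some l) => G (val k, val l)
    | (Some k, None) | (None, Some k) =>
        #|U|%:R^-1 * \sum_(i in U) G (val k, i)
    | (None, None) => (#|U|%:R ^+ 2)^-1 * \sum_(i in U) \sum_(j in U) G (i, j)
    end].

End reduction.

Arguments reduced_weight {R V} W U a b.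

(* Main.v *)
Require Import Defs.
From HB Require Import structures.
From mathcomp Require Import all_boot all_order perm all_algebra.
From mathcomp Require Import all_classical all_reals all_analysis.
From mathcomp Require Import measurable_realfun lebesgue_stieltjes_measure.
From mathcomp Require Import ring lra.

Set Implicit Arguments.
Unset Strict Implicit.
Unset Printing Implicit Defensive.

Import Order.TTheory GRing.Theory Num.Theory.
Import numFieldNormedType.Exports.

Local Open Scope classical_set_scope.
Local Open Scope ring_scope.

(** Put the vertices of [U] first and let [n] be their number. As [U] is
    indistinguishable from outside, the potential matrix of the full graph is
    [D, - 1^T w; - w^T 1, P] where [1] is the all-ones row and the row [w] does
    not depend on a vertex of [U]; that of the reduced graph is
    [2 b, - n w; - n w^T, P] with [b] the potential of the fused vertex.
    Eliminating the first block leaves the Schur complement [P - tau w^T w]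
    with [tau = 1 D^-1 1^T] on the one side and [P - (n ^ 2 / 2 b) w^T w] on
    the other. The two agree as soon as [2 b = n ^ 2 / tau]. Then the
    coarse-graining of the first inverse is the second inverse
    ([coarse_graining_green]), the first inverse is an explicit function of the
    second one and of [D^-1] ([reconstruct_green]), and the density of the full
    model times the one-vertex density at [2 b] is the density of [D] times the
    density of the reduced model ([density_exchange]).

    So [G] is obtained from [G'] by reading off [b], hence [tau], from [G'], and
    by drawing [D] from the law with density that of [D], conditioned on the
    value [tau] of [1 D^-1 1^T]. Two facts make this work: that quadratic form
    has the same law as [n ^ 2 / 2 b] in the one-vertex model, and the
    conditional law can be simulated measurably in [tau]. Both are contained in
    [sampler], for an arbitrary weight vector [e > 0] in the place of [1]: the
    law of [e D^-1 e^T] is the Levy law of the hitting time of the level [\sum e]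
    by a Brownian motion, whatever the graph.

    [sampler] goes by induction on the number of vertices. Eliminating the
    first one, with pivot [x], yields a potential of the same kind on the other
    vertices, with weights and vector that depend on [x], and
    [e D^-1 e^T = e_0 ^ 2 / x + t'] where [t'] is the quadratic form of the
    remaining potential ([potential_density_cons], [green_weight_cons]). By
    induction [t'] has a Levy law given [x], and [levy_first_line], which
    splits a hitting time at the first passage through a line, says that the
    total has the expected Levy law; it also gives the conditional density of
    [x] given the total, from which [x] is sampled by its quantile function
    ([pivot_sampling]). The statement on the joint law of the two Green matrices
    is [pair_law], and everything asserted on the extension [Omega * Xi]
    follows from it. *)

(** * Integration of non-negative functions *)

Section transfer.
Local Open Scope ereal_scope.
Import HBNNSimple.

Lemma density_measure d (T : measurableType d) (R : realType)
    (mu : {measure set T -> \bar R}) (f : T -> R) :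
  measurable_fun setT f -> (forall x, 0 <= f x)%R ->
  exists nu : {measure set T -> \bar R},
    (forall A, nu A = \int[mu]_(x in A) (f x)%:E) /\
    forall h : T -> \bar R, measurable_fun setT h -> (forall x, 0 <= h x) ->
      \int[nu]_x h x = \int[mu]_x ((f x)%:E * h x).
Proof.
move=> mf f0; pose m (A : set T) := \int[mu]_(x in A) (f x)%:E.
have m0 : m set0 = 0 by rewrite /m integral_set0.
have m_ge0 A : 0 <= m A by apply: integral_ge0 => x _; rewrite lee_fin.
have m_sigma : semi_sigma_additive m.
  move=> F mF tF mUF; apply: cvg_toP.
    apply: ereal_nondecreasing_is_cvgn => i j ij.
    by apply: lee_sum_nneg_natr => // k _ _; exact: m_ge0.
  rewrite /m ge0_integral_bigcup//=; last by move=> x _; rewrite lee_fin.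
  exact/measurable_EFinP/measurable_funTS.
pose mixin := isMeasure.Build _ _ _ m m0 m_ge0 m_sigma.
pose nu0 : {measure set T -> \bar R} := HB.pack m mixin.
have [nu nuE] : exists nu : {measure set T -> \bar R}, forall A, nu A = m A.
  by exists nu0.
exists nu; split=> // h mh h0; clear nu0 mixin.
pose h_ := nnsfun_approx measurableT mh.
have cvg_h_ x : (h_ n x)%:E @[n --> \oo] --> h x.
  by apply: cvg_nnsfun_approx => // y _; exact: h0.
transitivity (limn (fun n => \int[nu]_x (h_ n x)%:E)).
  rewrite -monotone_convergence//=.
  - by apply: eq_integral => x _; apply/esym/cvg_lim.
  - by move=> n; exact/measurable_EFinP.
  - by move=> n x _; rewrite lee_fin.
  - by move=> x _ i j ij; rewrite lee_fin; exact/lefP/nd_nnsfun_approx.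
transitivity (limn (fun n => \int[mu]_x ((f x)%:E * (h_ n x)%:E))); last first.
  rewrite -monotone_convergence//=.
  - apply: eq_integral => x _; apply/cvg_lim => //.
    by apply: cvgeZl.
  - by move=> n; apply: emeasurable_funM; exact/measurable_EFinP.
  - by move=> n x _; rewrite mule_ge0// lee_fin.
  - move=> x _ i j ij; rewrite -!EFinM lee_fin; apply: ler_wpM2l => //.
    exact/lefP/nd_nnsfun_approx.
apply/congr_lim/funext => n.
under eq_integral do rewrite fimfunE -fsumEFin//.
rewrite ge0_integral_fsum//; last 2 first.
  - by move=> r; exact/measurable_EFinP/measurableT_comp.
  - by move=> r x _; rewrite EFinM nnfun_muleindic_ge0.
under [RHS]eq_integral.
  move=> x _; rewrite fimfunE -fsumEFin// ge0_mule_fsumr; last first.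
    by move=> r; rewrite EFinM nnfun_muleindic_ge0.
  over.
rewrite ge0_integral_fsum//; last 2 first.
  - move=> r; apply: emeasurable_funM; apply/measurable_EFinP => //.
    exact: measurableT_comp.
  - by move=> r x _; rewrite mule_ge0 ?lee_fin// -lee_fin EFinM nnfun_muleindic_ge0.
apply: eq_fsbigr => r /set_mem [x0 _ rE].
have r0 : (0 <= r)%R by rewrite -rE.
rewrite integralZl_indic_nnsfun//= integral_indic//= setIT nuE /m.
under [RHS]eq_integral do rewrite EFinM muleCA.
rewrite ge0_integralZl//=.
- congr (_ * _); rewrite integral_mkcond; apply: eq_integral => x _.
  rewrite patchE indicE; case: ifPn => _; rewrite ?mule1 ?mule0//.
- by apply: emeasurable_funM; apply/measurable_EFinP => //.
- by move=> x _; rewrite mule_ge0// lee_fin.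
Qed.

(** Both sides are integrals of [h] against image measures on [Y], so that
    comparing these measures is enough. Changes of variable are instances where
    the comparison takes place on half-lines or boxes. *)
Lemma ge0_integral_transfer_gen d1 d2 d3 (S : measurableType d1)
    (T : measurableType d2) (Y : measurableType d3) (R : realType)
    (mu : {measure set S -> \bar R}) (nu : {measure set T -> \bar R})
    (p : S -> Y) (q : T -> Y) (f : S -> R) (g : T -> R) :
  measurable_fun setT p -> measurable_fun setT q ->
  measurable_fun setT f -> (forall x, 0 <= f x)%R ->
  measurable_fun setT g -> (forall x, 0 <= g x)%R ->
  (forall m1 m2 : {measure set Y -> \bar R},
    (forall A, m1 A = \int[mu]_(x in p @^-1` A) (f x)%:E) ->
    (forall A, m2 A = \int[nu]_(x in q @^-1` A) (g x)%:E) ->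
    forall A, measurable A -> m1 A = m2 A) ->
  forall h : Y -> \bar R, measurable_fun setT h -> (forall y, 0 <= h y) ->
    \int[mu]_x ((f x)%:E * h (p x)) = \int[nu]_x ((g x)%:E * h (q x)).
Proof.
move=> mp mq mf f0 mg g0 uniq h mh h0.
have [sigma [sigmaE sigma_int]] := density_measure mu mf f0.
have [rho [rhoE rho_int]] := density_measure nu mg g0.
have mhp : measurable_fun setT (h \o p) by exact: measurableT_comp.
have mhq : measurable_fun setT (h \o q) by exact: measurableT_comp.
rewrite -(sigma_int (h \o p))//; last by move=> x; exact: h0.
rewrite -(rho_int (h \o q))//; last by move=> x; exact: h0.
pose mixinp := isMeasurableFun.Build _ _ _ _ p mp.
pose p' : {mfun S >-> Y} := HB.pack p mixinp.
pose mixinq := isMeasurableFun.Build _ _ _ _ q mq.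
pose q' : {mfun T >-> Y} := HB.pack q mixinq.
rewrite -[LHS](@ge0_integral_pushforward _ _ _ _ _ p' mp sigma setT h)//.
rewrite -[RHS](@ge0_integral_pushforward _ _ _ _ _ q' mq rho setT h)//.
apply: eq_measure_integral => A mA _; apply: uniq => // B.
- exact: sigmaE.
- exact: rhoE.
Qed.

Lemma ge0_integral_transfer d1 d2 d3 (S : measurableType d1)
    (T : measurableType d2) (Y : measurableType d3) (R : realType)
    (mu : {measure set S -> \bar R}) (nu : {measure set T -> \bar R})
    (p : S -> Y) (q : T -> Y) (f : T -> R) :
  measurable_fun setT p -> measurable_fun setT q ->
  measurable_fun setT f -> (forall x, 0 <= f x)%R ->
  (forall A, measurable A ->
     mu (p @^-1` A) = \int[nu]_(x in q @^-1` A) (f x)%:E) ->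
  forall h : Y -> \bar R, measurable_fun setT h -> (forall y, 0 <= h y) ->
    \int[mu]_x h (p x) = \int[nu]_x ((f x)%:E * h (q x)).
Proof.
move=> mp mq mf f0 pq h mh h0.
transitivity (\int[mu]_x ((cst 1%R x)%:E * h (p x))).
  by apply: eq_integral => x _; rewrite mul1e.
apply: ge0_integral_transfer_gen => // m1 m2 m1E m2E A mA.
rewrite m1E m2E -pq//= integral_cst/= ?mul1e//.
by rewrite -[X in measurable X]setTI; exact: mp.
Qed.

(** Distribution functions determine a measure even if its total mass is
    infinite, provided that half-lines have a finite one. *)
Lemma measure_unique_itvNyc (R : realType)
    (m1 m2 : {measure set (measurableTypeR R) -> \bar R}) :
  (forall b, m1 `]-oo, b]%classic = m2 `]-oo, b]%classic) ->
  (forall b, m1 `]-oo, b]%classic < +oo) ->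
  forall A, measurable A -> m1 A = m2 A.
Proof.
move=> m12 m1oo.
pose G : set (set R) := [set `]-oo, b]%classic | b in setT].
apply: (@measure_unique _ R (measurableTypeR R) G
  (fun n => `]-oo, n%:R%R]%classic)).
- rewrite [LHS](RGenOInfty.measurableE R); apply/seteqP; split.
    apply: smallest_sub; first exact: smallest_sigma_algebra.
    move=> _ [x ->]; rewrite -setCitvl -setTD; apply: sigma_algebraCD.
    by apply: sub_sigma_algebra; exists x.
  apply: smallest_sub; first exact: smallest_sigma_algebra.
  move=> _ [x _ <-]; rewrite -setCitvr -setTD; apply: sigma_algebraCD.
  by apply: sub_sigma_algebra; exists x.
- move=> _ _ [a _ <-] [b _ <-]; exists (Num.min a b) => //.
  apply/seteqP; split => x /=; rewrite !in_itv/= le_min.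
    by move=> /andP[].
  by move=> [-> ->].
- by move=> n; exists n%:R%R.
- apply/seteqP; split => // x _; exists (Num.truncn x).+1 => //=.
  rewrite in_itv/= ltW//; exact: truncnS_gt.
- by move=> _ [b _ <-]; exact: m12.
- by move=> n; exact: m1oo.
Qed.

Lemma ge0_integral_affine (R : realType) (k c : R) (h : R -> \bar R) :
  (0 < k)%R -> measurable_fun setT h -> (forall x, 0 <= h x) ->
  \int[@lebesgue_measure R]_x h x
  = \int[@lebesgue_measure R]_x (k%:E * h (k * x + c)%R).
Proof.
move=> k0 mh h0.
pose q (x : R) : R := (k * x + c)%R.
have mq : @measurable_fun _ _ (measurableTypeR R) (measurableTypeR R) setT q.
  by apply: measurable_funD => //; exact: measurable_funM.
apply: (@ge0_integral_transfer _ _ _ _ _ (measurableTypeR R) R (@lebesgue_measure R)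
  (@lebesgue_measure R) id q (cst k)) => //; first by move=> x; exact: ltW.
have mk : measurable_fun [set: measurableTypeR R] (cst k) by [].
have [rho [rhoE _]] := @density_measure _ (measurableTypeR R) R
  (@lebesgue_measure R) (cst k) mk (fun=> ltW k0).
pose mixinq := @isMeasurableFun.Build _ _ (measurableTypeR R) (measurableTypeR R) q mq.
pose q' : {mfun measurableTypeR R >-> measurableTypeR R} := HB.pack q mixinq.
move=> A mA; rewrite preimage_id -rhoE -[RHS]/(pushforward rho q' A).
apply: lebesgue_measure_unique => //= _ [[a b] _ <-].
rewrite /pushforward rhoE (_ : q' @^-1` _ = `]((a - c) / k)%R, ((b - c) / k)%R]%classic).
  rewrite /= integral_cst//= !lebesgue_measure_itv/= !lte_fin ltr_pM2r ?invr_gt0//.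
  rewrite ltrD2r; case: ifPn => ab; last by rewrite mule0.
  rewrite -!EFinB -EFinM; congr _%:E.
  by rewrite -mulrBl mulrCA mulfV ?gt_eqF// mulr1; ring.
apply/seteqP; split => x /=; rewrite !in_itv/= ltr_pdivrMr// ler_pdivlMr//;
  by rewrite /q mulrC ltrBlDr lerBrDr.
Qed.

End transfer.

(** * Improper integrals by antiderivatives *)

Section improper.
Variable R : realType.
Let mu := @lebesgue_measure R.

(** Inversion is not continuous at [0], where its value is [0]; on the whole
    line it is [x * (x ^+ 2) `^ (-1)]. *)
Lemma measurable_invr : measurable_fun [set: R] (@GRing.inv R).
Proof.
rewrite (_ : GRing.inv = fun x : R => x * (x ^+ 2) `^ (-1)).
  apply: measurable_funM => //.
  apply: (@measurableT_comp _ _ _ _ _ _ (fun y : R => y `^ (-1))).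
    exact: measurable_powR.
  exact: measurable_funX.
apply/funext => x; rewrite powR_inv1 ?sqr_ge0//.
have [->|x0] := eqVneq x 0; first by rewrite invr0 mul0r.
by rewrite expr2 invfM mulrA mulfV// mul1r.
Qed.

Lemma measurable_funV d (T : measurableType d) (f : T -> R) :
  measurable_fun setT f -> measurable_fun setT (fun x => (f x)^-1).
Proof. by move=> mf; exact: measurableT_comp measurable_invr mf. Qed.

Lemma measurable_fun_div d (T : measurableType d) (f g : T -> R) :
  measurable_fun setT f -> measurable_fun setT g ->
  measurable_fun setT (fun x => f x / g x).
Proof. by move=> mf mg; apply: measurable_funM => //; exact: measurable_funV. Qed.

Lemma integral_antiderivative_itvcy (f F : R -> R) (a l : R) :
  (forall x : R, a <= x -> 0 <= f x) ->
  (forall x : R, a <= x -> is_derive x 1 F (f x)) ->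
  (forall x : R, a <= x -> {for x, continuous f}) ->
  F x @[x --> +oo] --> l ->
  (\int[mu]_(x in `[a, +oo[) (f x)%:E = (l - F a)%:E)%E.
Proof.
move=> f0 dF cf Fl; rewrite EFinB; apply: ge0_continuous_FTC2y => //.
- apply/continuous_within_itvcyP; split.
    by move=> x; rewrite in_itv/= andbT => /ltW; exact: cf.
  exact/cvg_at_right_filter/cf.
- by move=> x /ltW ax; have [] := dF x ax.
- apply: cvg_at_right_filter; apply: differentiable_continuous.
  by apply/derivable1_diffP; have [] := dF a (lexx a).
- move=> x; rewrite in_itv/= andbT => /ltW ax.
  by rewrite derive1E; have [] := dF x ax.
Qed.

(** The antiderivative need not extend to [0]: the half-line is exhausted by
    the intervals from [1 / n.+1] to infinity. *)
Lemma integral_antiderivative_itvoy (f F : R -> R) (l0 l1 : R) :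
  (forall x : R, 0 < x -> 0 <= f x) ->
  (forall x : R, 0 < x -> is_derive x 1 F (f x)) ->
  (forall x : R, 0 < x -> {for x, continuous f}) ->
  F x @[x --> 0^'+] --> l0 -> F x @[x --> +oo] --> l1 ->
  (\int[mu]_(x in `]0%R, +oo[) (f x)%:E = (l1 - l0)%:E)%E.
Proof.
move=> f0 dF cf F0 Fy.
pose I (n : nat) : set R := `[n.+1%:R^-1, +oo[%classic.
have n0 n : 0 < n.+1%:R^-1 :> R by rewrite invr_gt0.
have IE n : (\int[mu]_(x in I n) (f x)%:E = (l1 - F n.+1%:R^-1)%:E)%E.
  apply: integral_antiderivative_itvcy => // x nx; have x0 := lt_le_trans (n0 n) nx.
  - exact: f0.
  - exact: dF.
  - exact: cf.
have UI : `](0:R), +oo[%classic = \bigcup_n I n.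
  apply/seteqP; split => [x/=|x [n _]]; rewrite /I/= !in_itv/= !andbT.
    move=> x0; exists (Num.truncn x^-1) => //=; rewrite /I/= in_itv/= andbT.
    by rewrite -[leRHS]invrK lef_pV2 ?posrE ?invr_gt0// ltW// truncnS_gt.
  exact: lt_le_trans.
have ndI : nondecreasing_seq I.
  move=> m n mn; rewrite subsetEset => x; rewrite /I/= !in_itv/= !andbT.
  by apply: le_trans; rewrite lef_pV2 ?posrE ?ler_nat.
have := @ge0_nondecreasing_set_cvg_integral _ (measurableTypeR R) R I (EFin \o f)
  (@lebesgue_measure R) ndI.
rewrite -UI => cvgI.
have mf n : measurable_fun (I n) (EFin \o f).
  apply/measurable_EFinP.
  have mo : measurable_fun `](0:R), +oo[ f.
    apply: open_continuous_measurable_fun => [|x].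
      exact: interval_open.
    by rewrite inE/= in_itv/= andbT; exact: cf.
  apply: measurable_funS mo => // x; rewrite /I/= !in_itv/= !andbT.
  exact: lt_le_trans.
have h1 := cvgI (fun n => measurable_itv _) mf.
apply: (cvg_unique (@ereal_hausdorff R) (h1 _)).
  move=> n x; rewrite /I/= in_itv/= andbT => nx.
  by rewrite lee_fin f0// (lt_le_trans _ nx).
rewrite (_ : (fun n => _) = EFin \o (fun n => l1 - F n.+1%:R^-1)); last first.
  by apply/funext => n; rewrite IE.
apply: cvg_EFin; first by apply: nearW.
apply: cvgB; first exact: cvg_cst.
move/cvg_at_rightP : F0; apply; split => //.
apply/gtr0_cvgV0; first exact: nearW.
by rewrite (@cvg_shiftS R (fun n => n%:R)); exact: cvgr_idn.
Qed.

End improper.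

(** It is enough to compare half-lines: [k / x] is at most [b > 0] exactly from
    [k / b] on, and the integral of [k / x ^+ 2] from there to infinity is
    [b]. *)
Lemma ge0_integral_inversion (R : realType) (k : R) (h : R -> \bar R) :
  (0 < k)%R -> measurable_fun setT h -> (forall x, 0 <= h x)%E ->
  (\int[@lebesgue_measure R]_x ((0 < x)%R%:R%:E * h x)
  = \int[@lebesgue_measure R]_x ((if 0 < x then k / x ^+ 2 else 0)%R%:E * h (k / x)%R))%E.
Proof.
move=> k0 mh h0.
have mq : @measurable_fun _ _ (measurableTypeR R) (measurableTypeR R) setT (fun x : R => k / x).
  by apply: measurable_fun_div.
have mpos : measurable_fun [set: R] (fun x => 0 < x) by exact: measurable_fun_ltr.
apply: (@ge0_integral_transfer_gen _ _ _ (measurableTypeR R) (measurableTypeR R)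
  (measurableTypeR R) R (@lebesgue_measure R) (@lebesgue_measure R) id
  (fun x => k / x) (fun x => (0 < x)%R%:R) (fun x => if 0 < x then k / x ^+ 2 else 0)) => //.
- rewrite (_ : (fun x : R => _) = (fun x : R => if 0 < x then 1 else 0)).
    by apply: measurable_fun_ifT.
  by apply/funext => x; case: ifP.
- apply: measurable_fun_ifT => //; apply: measurable_fun_div => //.
- by move=> x; case: ifPn => // x0; apply: divr_ge0; [exact: ltW|exact: sqr_ge0].
move=> m1 m2 m1E m2E.
have m1b b : (m1 `]-oo, b]%classic = (Num.max b 0)%:E)%E.
  rewrite m1E preimage_id.
  transitivity (\int[@lebesgue_measure R]_(x in `]0%R, b]) 1%:E)%E.
    rewrite integral_mkcond [RHS]integral_mkcond; apply: eq_integral => x _.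
    rewrite !patchE !mem_setE !in_itv/=.
    by case: (0 < x); case: (x <= b).
  rewrite integral_cst//= mul1e lebesgue_measure_itv/= lte_fin.
  by case: ltP => b0 //; rewrite -EFinD subr0.
apply: measure_unique_itvNyc => b; last by rewrite m1b ltry.
rewrite m1b m2E; have [b0|b0] := leP b 0.
  rewrite integral_mkcond [RHS]integral0_eq//= => x _; rewrite patchE.
  case: ifPn => //; rewrite inE/= in_itv/= => xb; case: ifPn => // x0.
  by have := lt_le_trans (divr_gt0 k0 x0) (le_trans xb b0); rewrite ltxx.
transitivity (\int[@lebesgue_measure R]_(x in `[(k / b)%R, +oo[) (k / x ^+ 2)%:E)%E.
  transitivity (0 - - (k * (k / b)^-1))%:E.
    by rewrite sub0r opprK invf_div mulrCA mulfV ?gt_eqF// mulr1.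
  symmetry.
  apply: (@integral_antiderivative_itvcy R (fun x => k / x ^+ 2)
    (fun x => - (k * x^-1)) (k / b) 0).
  - by move=> x xb; apply: divr_ge0; [exact: ltW|exact: sqr_ge0].
  - move=> x xb; have x0 : x != 0 by rewrite gt_eqF// (lt_le_trans _ xb)// divr_gt0.
    have dV := is_deriveN (is_deriveZ k (is_deriveV x0 (is_derive_id x 1))).
    apply: (is_derive_eq dV).
    by rewrite /GRing.scale/= mulr1 mulrN opprK.
  - move=> x xb; have x0 : 0 < x by rewrite (lt_le_trans _ xb)// divr_gt0.
    apply: continuousM; first exact: cst_continuous.
    by apply: continuousV; [rewrite expf_neq0// gt_eqF|exact: exprn_continuous].
  - rewrite -oppr0 -[in X in _ --> X](mulr0 k); apply: cvgN; apply: cvgMr.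
    by apply/gtr0_cvgV0; [near=> x|exact: cvg_id].
rewrite [LHS]integral_mkcond [RHS]integral_mkcond; apply: eq_integral => x _.
have inl : (x \in `[k / b, +oo[%classic) = (k / b <= x).
  by rewrite mem_setE in_itv/= andbT.
have inr : (x \in (fun y : R => k / y) @^-1` `]-oo, b]) = (k / x <= b).
  by apply/idP/idP; rewrite inE/= in_itv.
rewrite !patchE inl inr.
have [x0|x0] := ltP 0 x; first by rewrite !ler_pdivrMr// mulrC.
by rewrite leNgt (le_lt_trans x0) ?divr_gt0//=; case: ifP.
Unshelve. all: end_near. Qed.

(** * Sampling from a parametrised density *)

Section quantile.
Variable R : realType.
Local Notation mR := (measurableTypeR R).

(** The quantile is the infimum of the points where [F] exceeds [u]; by right
    continuity it is one of them, which makes the equivalence hold at the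
    boundary as well. *)
Lemma quantile_exists (F : R -> \bar R) (u : R) :
  nondecreasing_fun F -> right_continuous F ->
  F @ +oo%R --> 1%E -> F @ -oo%R --> 0%E -> 0 < u < 1 ->
  exists q, forall x, (u%:E <= F x)%E = (q <= x).
Proof.
move=> ndF rcF Fy FNy /andP[u0 u1].
pose S := [set x | (u%:E <= F x)%E].
have S0 : S !=set0.
  have Fo : nbhs 1%E [set y | (u%:E < y)%E].
    apply: open_nbhs_nbhs; split; first exact: open_ereal_gt_ereal.
    by rewrite /= lte_fin.
  have Fn : \forall x \near +oo%R, (u%:E < F x)%E := Fy _ Fo.
  by have [x ux] := filter_ex Fn; exists x; exact: ltW.
have lbS : has_lbound S.
  have Fo : nbhs 0%E [set y | (y < u%:E)%E].
    apply: open_nbhs_nbhs; split; first exact: open_ereal_lt_ereal.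
    by rewrite /= lte_fin.
  have Fn : \forall x \near -oo%R, (F x < u%:E)%E := FNy _ Fo.
  have [x xu] := filter_ex Fn.
  exists x => y Sy; rewrite leNgt; apply/negP => yx.
  have := lt_le_trans xu (le_trans Sy (ndF _ _ (ltW yx))).
  by rewrite ltxx.
exists (inf S) => x; apply/idP/idP => [Sx|qx]; first exact: ge_inf.
apply: le_trans (ndF _ _ qx); rewrite leNgt; apply/negP => Fq.
have Fo : nbhs (F (inf S)) [set y | (y < u%:E)%E].
  by apply: open_nbhs_nbhs; split; first exact: open_ereal_lt_ereal.
have Fn : \forall y \near (inf S)^'+, (F y < u%:E)%E := rcF (inf S) _ Fo.
have [y [qy yu]] := filter_ex (filterI (nbhs_right_gt (inf S)) Fn).
have yq : 0 < y - inf S by rewrite subr_gt0.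
have [s Ss] := inf_adherent yq (conj S0 lbS); rewrite subrKC => sy.
by have := lt_le_trans yu (le_trans Ss (ndF _ _ (ltW sy))); rewrite ltxx.
Qed.

Lemma uniform_noise :
  exists Q : probability mR R,
    forall A, Q A = (@lebesgue_measure R (A `&` `](0:R), (1:R)[%classic)).
Proof.
have mI : measurable (`](0:R), (1:R)[%classic : set mR) by exact: measurable_itv.
have m1 : mrestr (@lebesgue_measure R) mI setT = 1%E.
  by rewrite /mrestr setTI lebesgue_measure_itv/= lte_fin ltr01 -EFinD subr0.
pose mixin := Measure_isProbability.Build _ _ _ (mrestr (@lebesgue_measure R) mI) m1.
pose Q : probability mR R := HB.pack (mrestr (@lebesgue_measure R) mI) mixin.
by exists Q.
Qed.

(** The quantile transform, with a single noise for all parameters [b]. The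
    quantile is jointly measurable in [(b, u)] because it is at most [x] exactly
    when [u <= F b x]; it is set to [0] unless [0 < u < 1], which is almost
    surely the case. *)
Lemma quantile_sampling d (B : measurableType d) (g : B * mR -> R) :
  measurable_fun setT g -> (forall x, 0 <= g x) ->
  (forall b, \int[@lebesgue_measure R]_x (g (b, x))%:E = 1)%E ->
  exists (Q : probability mR R) (phi : B * mR -> mR),
    measurable_fun setT phi /\
    forall b (h : mR -> \bar R), measurable_fun setT h -> (forall x, 0 <= h x)%E ->
      (\int[Q]_u h (phi (b, u)) =
       \int[@lebesgue_measure R]_x ((g (b, x))%:E * h x))%E.
Proof.
move=> mg g0 g1.
have [Q QE] := uniform_noise; exists Q.
have mgb b : measurable_fun setT (fun x : mR => g (b, x)).
  exact: measurableT_comp mg (measurable_pair1 b).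
pose F b x := (\int[@lebesgue_measure R]_(y in `]-oo, x]) (g (b, y))%:E)%E.
have cdfF b : [/\ nondecreasing_fun (F b), right_continuous (F b),
    F b @ +oo%R --> 1%E, F b @ -oo%R --> 0%E & forall x, (0 <= F b x <= 1)%E].
  have [nu [nuE _]] := density_measure (@lebesgue_measure R) (mgb b)
    (fun x => g0 (b, x)).
  have nu1 : mrestr nu measurableT setT = 1%E by rewrite /mrestr setTI nuE g1.
  pose mixin := Measure_isProbability.Build _ _ _ (mrestr nu measurableT) nu1.
  pose N : probability mR R := HB.pack (mrestr nu measurableT) mixin.
  pose Xmixin := @isMeasurableFun.Build _ _ mR R idfun (@measurable_id _ mR setT).
  pose X : {RV N >-> R} := HB.pack (idfun : mR -> R) Xmixin.
  have -> : F b = cdf X.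
    by apply/funext => x; rewrite /cdf /distribution/= /pushforward preimage_id /mrestr setIT nuE.
  split; last by move=> x; rewrite cdf_ge0 cdf_le1.
  - exact: cdf_nondecreasing.
  - exact: cdf_right_continuous.
  - exact: cvg_cdfy1.
  - exact: cvg_cdfNy0.
have mF x : measurable_fun setT (fun b => F b x).
  pose G (p : B * mR) := (if p.2 <= x then g p else 0)%:E.
  rewrite (_ : (fun b => _) =
      fubini_F (@lebesgue_measure R : {sigma_finite_measure set mR -> \bar R}) G).
    apply: measurable_fun_fubini_tonelli_F.
      apply/measurable_EFinP; apply: measurable_fun_ifT => //.
      exact: measurable_fun_ler.
    by move=> p; rewrite /G; case: ifP; rewrite lee_fin.
  apply/funext => b; rewrite /F /fubini_F/= [LHS]integral_mkcond; apply: eq_integral => y _.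
  by rewrite patchE /G/= mem_setE in_itv/=; case: ifP.
have ex_q (p : B * mR) : exists q : R,
    if 0 < p.2 < 1 then forall x, (p.2%:E <= F p.1 x)%E = (q <= x) else q = 0.
  have [u01|_] := boolP (0 < p.2 < 1); last by exists 0.
  by have [? ? ? ? _] := cdfF p.1; exact: quantile_exists.
have [phi phiE] := choice ex_q; exists phi.
have phi_le p x : (phi p <= x) =
    if 0 < p.2 < 1 then (p.2%:E <= F p.1 x)%E else (0 <= x).
  by have := phiE p; case: (boolP (0 < p.2 < 1)) => _ => [->|->].
have mphi : measurable_fun setT phi.
  apply: (measurability _ (RGenOInfty.measurableE R)) => _ [_ [x ->] <-].
  rewrite setTI -setCitvl preimage_setC; apply: measurableC.
  rewrite [X in measurable X](_ : _ = (fun p : B * mR =>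
      if 0 < p.2 < 1 then (p.2%:E <= F p.1 x)%E else (0 <= x)) @^-1` [set true]).
    2: by apply/seteqP; split => p /=; rewrite in_itv/= phi_le.
  rewrite -[X in measurable X]setTI.
  apply: measurable_fun_ifT => //.
  - by apply: measurable_and; apply: measurable_fun_ltr.
  - apply: measurable_fun_lee.
    + exact/measurable_EFinP.
    + exact: measurableT_comp (mF x) measurable_fst.
split => // b h mh h0.
have mphib : measurable_fun setT (fun u => phi (b, u)).
  exact: measurableT_comp mphi (measurable_pair1 b).
have [_ _ _ _ F01] := cdfF b.
transitivity (\int[Q]_u ((cst 1%R u)%:E * h (phi (b, u))))%E.
  by apply: eq_integral => u _; rewrite mul1e.
apply: (@ge0_integral_transfer_gen _ _ _ mR mR mR R Q (@lebesgue_measure R)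
   (fun u => phi (b, u)) id) => // m1 m2 m1E m2E.
have m1b x : m1 `]-oo, x]%classic = F b x.
  have mpre : measurable ((fun u => phi (b, u)) @^-1` `]-oo, x]).
    by rewrite -[X in measurable X]setTI; exact: mphib.
  rewrite m1E /= integral_cst//= mul1e QE.
  have := F01 x; case Fbx: (F b x) => [r||]; rewrite ?leye_eq ?andbF//.
  rewrite !lee_fin => /andP[r0 r1].
  have -> : (fun u => phi (b, u)) @^-1` `]-oo, x] `&` `]0, 1[
      = [set` Interval (BRight 0) (BSide (r == 1) r)] :> set R.
    have [r_1|r_n1] := eqVneq r 1; apply/seteqP; split => u /=; rewrite !in_itv/=.
    - by rewrite r_1 => -[_].
    - move=> /andP[u0]; rewrite r_1 => u1; split; last by rewrite u0.
      by rewrite phi_le /= u0 u1 Fbx lee_fin r_1 ltW.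
    - by move=> [+ /andP[u0 u1]]; rewrite phi_le /= u0 u1 Fbx lee_fin.
    - move=> /andP[u0 ur]; have u1 : u < 1.
        by rewrite (le_lt_trans ur)// lt_neqAle r_n1.
      by rewrite phi_le /= u0 u1 Fbx lee_fin.
  rewrite lebesgue_measure_itv/= lte_fin.
  by case: ltP => [_|r0']; [rewrite -EFinD subr0|congr _%:E; apply/eqP; rewrite eq_le r0 r0'].
apply: measure_unique_itvNyc => x.
  by rewrite m1b m2E preimage_id.
rewrite m1b; have /andP[_ F1] := F01 x.
by rewrite (le_lt_trans F1)// ltry.
Qed.

End quantile.

(** * An integral of inverse Gaussian type *)

Section hitting_times.
Variable R : realType.
Let mu := @lebesgue_measure R.
Local Notation mR := (measurableTypeR R).

Definition normal_cdf (y : R) : R := \int[mu]_(x in `]-oo, y]) normal_pdf 0 1 x.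

Lemma normal_pdf01 (x : R) :
  normal_pdf 0 1 x = (Num.sqrt (2 * pi))^-1 * expR (- x ^+ 2 / 2).
Proof.
rewrite normal_pdfE ?oner_neq0// /normal_peak /normal_fun subr0 expr1n mul1r.
by rewrite mulr_natl.
Qed.

Lemma is_derive_normal_cdf (y : R) : is_derive y 1 normal_cdf (normal_pdf 0 1 y).
Proof.
have [] := @continuous_FTC1 R (normal_pdf 0 1) -oo%O y (y + 1).
- by rewrite ltrDl.
- have := @integrable_normal_pdf R 0 1; apply: integrableS => //.
- by rewrite ltNyr.
- by apply: continuous_normal_pdf; rewrite oner_neq0.
move=> dN N'; apply: DeriveDef; first exact: dN.
by rewrite -derive1E.
Qed.

Lemma normal_cdf_cvg :
  normal_cdf y @[y --> +oo] --> (1 : R) /\ normal_cdf y @[y --> -oo] --> (0 : R).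
Proof.
pose P := @normal_prob R 0 1.
pose Xmixin := @isMeasurableFun.Build _ _ mR R idfun (@measurable_id _ mR setT).
pose X : {RV P >-> R} := HB.pack (idfun : mR -> R) Xmixin.
have -> : normal_cdf = fine \o cdf X.
  by apply/funext => y; rewrite /= preimage_id.
split; apply: fine_cvg; [exact: cvg_cdfy1|exact: cvg_cdfNy0].
Qed.

Lemma cvgy_sqrt : (Num.sqrt x : R) @[x --> +oo%R] --> +oo%R.
Proof.
apply/cvgryPge => A; near=> x.
have Ax : A ^+ 2 <= x by near: x; exact/nbhs_pinfty_ge/num_real.
by rewrite (le_trans (ler_norm A))// -sqrtr_sqr ler_wsqrtr.
Unshelve. all: end_near. Qed.

Lemma cvg_sqrtV0 : ((Num.sqrt x)^-1 : R) @[x --> 0^'+] --> +oo%R.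
Proof.
apply/cvgrVy; first by near=> x; rewrite sqrtr_gt0.
rewrite -[in X in _ --> X](@sqrtr0 R).
apply: cvg_at_right_filter; exact: sqrt_continuous.
Unshelve. all: end_near. Qed.

(** The distribution function of an inverse Gaussian law is a combination of
    values of the normal one at points of this form. *)
Let zeta (c d v : R) := c * Num.sqrt v + d * (Num.sqrt v)^-1.

Lemma is_derive_zeta (c d v : R) : 0 < v ->
  is_derive v 1 (zeta c d) ((c - d / v) / (2 * Num.sqrt v)).
Proof.
move=> v0; have sv0 : Num.sqrt v != 0 by rewrite gt_eqF// sqrtr_gt0.
have dS := is_derive1_sqrt v0.
have dZ := is_deriveD (is_deriveZ c dS) (is_deriveZ d (is_deriveV sv0 dS)).
apply: (is_derive_eq dZ); rewrite /GRing.scale/=.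
rewrite -[X in _ - d / X](sqr_sqrtr (ltW v0)); field.
by rewrite sv0.
Qed.

Lemma zeta_cvgy (c d : R) : 0 < c -> zeta c d v @[v --> +oo] --> +oo.
Proof.
move=> c0; apply: (@ger_cvgy _ _ _ _ (fun v => c * Num.sqrt v - `|d|)).
  near=> v; rewrite /zeta lerD2l.
  have v1 : 1 <= Num.sqrt v.
    by rewrite -sqrtr1 ler_wsqrtr//; near: v; exact: nbhs_pinfty_ge.
  have : `|d * (Num.sqrt v)^-1| <= `|d|.
    rewrite normrM ler_piMr// ger0_norm ?invr_ge0 ?sqrtr_ge0//.
    by rewrite invf_le1// (lt_le_trans ltr01).
  by rewrite ler_norml => /andP[].
apply/cvgryPge => A.
have cS : c * Num.sqrt v @[v --> +oo] --> +oo.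
  exact: (@gt0_cvgMry R (pinfty_nbhs R) _ c _ c0 cvgy_sqrt).
move/cvgryPge : cS => /(_ (A + `|d|)).
by apply: filterS => x; rewrite lerBrDr.
Unshelve. all: end_near. Qed.

Lemma zeta_cvg0 (c d : R) : 0 < c -> 0 < d -> zeta c d v @[v --> 0^'+] --> +oo.
Proof.
move=> c0 d0; apply: (@ger_cvgy _ _ _ _ (fun v => d * (Num.sqrt v)^-1)).
  by near=> v; rewrite /zeta lerDr mulr_ge0 ?sqrtr_ge0// ltW.
by apply: gt0_cvgMry => //; exact: cvg_sqrtV0.
Unshelve. all: end_near. Qed.

Lemma zeta_cvg0N (c d : R) : 0 < c -> 0 < d -> zeta c (- d) v @[v --> 0^'+] --> -oo.
Proof.
move=> c0 d0; apply: (@ler_cvgNy _ _ _ _ (fun v => c - d * (Num.sqrt v)^-1)).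
  near=> v; rewrite /zeta mulNr lerD2r ger_pMr// -sqrtr1 ler_wsqrtr//.
  by near: v; apply: nbhs_right_le.
apply/cvgrNyPle => A.
have dS : d * (Num.sqrt v)^-1 @[v --> 0^'+] --> +oo.
  by apply: gt0_cvgMry => //; exact: cvg_sqrtV0.
move/cvgryPge : dS => /(_ (c - A)).
by apply: filterS => x; rewrite lerBlDr lerBlDl.
Unshelve. all: end_near. Qed.

Definition ig_kernel (A s m t v : R) :=
  (A * v + m) / (v * Num.sqrt v) * expR (- (s * v - m) ^+ 2 / (2 * t * v)).

(** With [z1], [z2] equal to [(s v - m) / sqrt (t v)] and
    [(s v + m) / sqrt (t v)], one has [z2 ^ 2 = z1 ^ 2 + 4 s m / t]. Hence
    [exp (- z1 ^ 2 / 2) = K exp (- z2 ^ 2 / 2)], so that the derivatives of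
    [normal_cdf z1] and [K * normal_cdf z2] are both this Gaussian factor times
    [s v + m] or [s v - m], up to a common power of [v]. The coefficients [a]
    and [b] combine these into [A v + m]. *)
Lemma integral_ig_kernel (A s m t : R) : 0 <= A -> 0 < s -> 0 < m -> 0 < t ->
  (\int[mu]_(v in `]0%R, +oo[) (ig_kernel A s m t v)%:E =
   (Num.sqrt (2 * pi) * Num.sqrt t * ((A + s) / s))%:E)%E.
Proof.
move=> A0 s0 m0 t0.
pose T := Num.sqrt t; pose P := Num.sqrt (2 * pi : R).
have T0 : 0 < T by rewrite sqrtr_gt0.
have P0 : 0 < P by rewrite sqrtr_gt0 mulr_gt0// pi_gt0.
have tE : t = T ^+ 2 by rewrite sqr_sqrtr// ltW.
pose K := expR (2 * s * m / t).
pose a := (A + s) / (2 * s); pose b := (A - s) / (2 * s).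
pose z1 := zeta (s / T) (- (m / T)); pose z2 := zeta (s / T) (m / T).
pose F v := P * 2 * T * (a * normal_cdf (z1 v) + b * K * normal_cdf (z2 v)).
have [cy cNy] := normal_cdf_cvg.
have sT : 0 < s / T by rewrite divr_gt0.
have mT : 0 < m / T by rewrite divr_gt0.
(* [z2] tends to [+oo] at both ends, so only the [z1] term contributes. *)
have -> : (P * T * ((A + s) / s)) =
    P * 2 * T * (a * 1 + b * K * 1) - P * 2 * T * (a * 0 + b * K * 1).
  by rewrite /a; field; rewrite gt_eqF.
apply: (@integral_antiderivative_itvoy R (ig_kernel A s m t) F).
- move=> v v0; rewrite mulr_ge0 ?expR_ge0// divr_ge0 ?mulr_ge0 ?sqrtr_ge0 ?ltW//.
  by rewrite ltr_wpDl ?mulr_ge0// ltW.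
- move=> v v0.
  have dz1 := is_derive_zeta (s / T) (- (m / T)) v0.
  have dz2 := is_derive_zeta (s / T) (m / T) v0.
  have d1 := is_derive1_comp (is_derive_normal_cdf (z1 v)) dz1.
  have d2 := is_derive1_comp (is_derive_normal_cdf (z2 v)) dz2.
  have dF := is_deriveZ (P * 2 * T) (is_deriveD (is_deriveZ a d1) (is_deriveZ (b * K) d2)).
  apply: (is_derive_eq dF); rewrite /GRing.scale/= !normal_pdf01 -/P.
  set S := Num.sqrt v.
  have S0 : 0 < S by rewrite sqrtr_gt0.
  have vE : v = S ^+ 2 by rewrite sqr_sqrtr// ltW.
  have z12 : expR (- z1 v ^+ 2 / 2) = K * expR (- z2 v ^+ 2 / 2).
    rewrite /K -expRD; congr expR; rewrite /z1 /z2 /zeta -/S tE; field.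
    by rewrite !gt_eqF.
  have z1E : - z1 v ^+ 2 / 2 = - (s * v - m) ^+ 2 / (2 * t * v).
    rewrite /z1 /zeta -/S tE vE; field.
    by rewrite !gt_eqF.
  rewrite /ig_kernel -/S -z1E z12 /a /b vE.
  move: (expR (- z2 v ^+ 2 / 2)) => E2; field.
  by rewrite !gt_eqF.
- move=> v v0; have S0 : 0 < Num.sqrt v by rewrite sqrtr_gt0.
  apply: continuousM; [apply: continuousM|].
  + apply: continuousD; last exact: cst_continuous.
    by apply: continuousM; [exact: cst_continuous|exact: cvg_id].
  + apply: continuousV; first by rewrite gt_eqF// mulr_gt0.
    by apply: continuousM; [exact: cvg_id|exact: sqrt_continuous].
  + apply: (@continuous_comp _ _ _ (fun v => - (s * v - m) ^+ 2 / (2 * t * v)) expR);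
      last exact: continuous_expR.
    apply: continuousM.
    * apply: continuousN.
      apply: (@continuous_comp _ _ _ (fun v => s * v - m) (fun y => y ^+ 2)).
        apply: continuousB; last exact: cst_continuous.
        by apply: continuousM; [exact: cst_continuous|exact: cvg_id].
      exact: exprn_continuous.
    * apply: continuousV; first by rewrite gt_eqF// mulr_gt0// mulr_gt0.
      by apply: continuousM; [exact: cst_continuous|exact: cvg_id].
- apply: cvgMr; apply: cvgD; apply: cvgMr.
  + exact: cvg_comp (zeta_cvg0N sT mT) cNy.
  + exact: cvg_comp (zeta_cvg0 sT mT) cy.
- apply: cvgMr; apply: cvgD; apply: cvgMr.
  + exact: cvg_comp (zeta_cvgy _ sT) cy.
  + exact: cvg_comp (zeta_cvgy _ sT) cy.
Qed.

End hitting_times.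

(** * Levy laws and the first passage through a line *)

Section measurability.
Context d (T : measurableType d) (R : realType).
Implicit Types f g : T -> R.

Lemma measurable_fun_sqrt f :
  measurable_fun setT f -> measurable_fun setT (fun x => Num.sqrt (f x)).
Proof.
apply: measurableT_comp; apply: continuous_measurable_fun.
exact: sqrt_continuous.
Qed.

Lemma measurable_fun_expR f :
  measurable_fun setT f -> measurable_fun setT (fun x => expR (f x)).
Proof. by apply: measurableT_comp. Qed.

End measurability.

Ltac measurability_step := first
  [ exact: measurable_cst | assumption | exact: measurable_fst
  | exact: measurable_snd | exact: measurable_id
  | apply: measurable_fun_ifT | apply: measurable_fun_ltr
  | apply: measurable_fun_sqrt | apply: measurable_fun_expR
  | apply: measurable_funV | apply: measurable_funX | apply: measurable_funN
  | apply: measurable_funB | apply: measurable_funD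
  | apply: measurable_funM ].

Section levy.
Variable R : realType.
Local Notation mR := (measurableTypeR R).
Let mu := @lebesgue_measure R.

(** Density of the time at which a Brownian motion started at [0] hits [a]. *)
Definition levy (a t : R) : R :=
  if 0 < t then
    a / (Num.sqrt (2 * pi) * (t * Num.sqrt t)) * expR (- (a ^+ 2 / (2 * t)))
  else 0.

(** If [y] is the time at which a Brownian motion started at [0] hits the line
    [y |-> s - (r / s) * y], an inverse Gaussian variable, this is the density
    of [s ^+ 2 / y]; it does not depend on [s], and for [r = 0] it is the
    density of the square of a standard normal variable. *)
Definition recip_inverse_gaussian (r x : R) : R :=
  if 0 < x then
    (Num.sqrt (2 * pi) * Num.sqrt x)^-1 *
    expR (- ((x + r ^+ 2 / x - 2 * r) / 2))
  else 0.

Lemma levy_ge0 a t : 0 <= a -> 0 <= levy a t.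
Proof.
move=> a0; rewrite /levy; case: ifPn => // t0.
by rewrite mulr_ge0 ?expR_ge0// divr_ge0// !mulr_ge0 ?sqrtr_ge0// ltW.
Qed.

Lemma levy_gt0 a t : 0 < a -> 0 < t -> 0 < levy a t.
Proof.
move=> a0 t0; rewrite /levy t0 mulr_gt0 ?expR_gt0// divr_gt0// !mulr_gt0//.
  by rewrite sqrtr_gt0 mulr_gt0// pi_gt0.
by rewrite sqrtr_gt0.
Qed.

Lemma recip_inverse_gaussian_ge0 r x : 0 <= recip_inverse_gaussian r x.
Proof.
by rewrite /recip_inverse_gaussian; case: ifPn.
Qed.

Lemma measurable_fun_levy d (T : measurableType d) (a t : T -> R) :
  measurable_fun setT a -> measurable_fun setT t ->
  measurable_fun setT (fun x => levy (a x) (t x)).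
Proof. by move=> ma mt; rewrite /levy; repeat measurability_step. Qed.

Lemma measurable_fun_recip_inverse_gaussian d (T : measurableType d) (r x : T -> R) :
  measurable_fun setT r -> measurable_fun setT x ->
  measurable_fun setT (fun y => recip_inverse_gaussian (r y) (x y)).
Proof. by move=> mr mx; rewrite /recip_inverse_gaussian; repeat measurability_step. Qed.

(** The substitution [x = (s ^+ 2 / t) * (1 + v)] is affine, sends [v > 0] to
    the [x] for which the remaining time [t - s ^+ 2 / x] is positive, and
    separates the variables in the exponent. *)
Let convolution_kernel (r s A t v : R) : 0 <= r -> 0 < s -> 0 < A -> 0 < t -> 0 < v ->
  let m := r * t / s + A in let x := s ^+ 2 / t * v + s ^+ 2 / t in
  s ^+ 2 / t * (recip_inverse_gaussian r x * levy (A + r * s / x) (t - s ^+ 2 / x)) =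
  s / (2 * pi * t ^+ 2) * expR (- ((A + s) ^+ 2 / (2 * t))) *
  ig_kernel A s m t v.
Proof.
move=> r0 s0 A0 t0 v0 m x.
have v1 : 0 < 1 + v by rewrite addr_gt0.
have xE : x = s ^+ 2 * (1 + v) / t by rewrite /x; field; rewrite gt_eqF.
have x0 : 0 < x by rewrite xE divr_gt0// mulr_gt0// exprn_gt0.
have tE : t - s ^+ 2 / x = t * v / (1 + v).
  by rewrite xE; field; rewrite !gt_eqF.
have aE : A + r * s / x = (A * v + m) / (1 + v).
  by rewrite xE /m; field; rewrite !gt_eqF.
rewrite /recip_inverse_gaussian /levy /ig_kernel x0 tE aE divr_gt0 ?mulr_gt0//.
rewrite [LHS](_ : _ = s ^+ 2 / t *
  ((Num.sqrt (2 * pi) * Num.sqrt x)^-1 * ((A * v + m) / (1 + v) /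
   (Num.sqrt (2 * pi) * (t * v / (1 + v) * Num.sqrt (t * v / (1 + v))))) *
  (expR (- ((x + r ^+ 2 / x - 2 * r) / 2)) *
   expR (- (((A * v + m) / (1 + v)) ^+ 2 / (2 * (t * v / (1 + v)))))))); last by ring.
rewrite -expRD [in expR _](_ : _ + _ =
  - ((A + s) ^+ 2 / (2 * t)) + - (s * v - m) ^+ 2 / (2 * t * v)); last first.
  by rewrite xE /m; field; rewrite !gt_eqF.
rewrite expRD xE.
have s2 : Num.sqrt (s ^+ 2 * (1 + v) / t) = s * Num.sqrt (1 + v) / Num.sqrt t.
  rewrite sqrtrM ?mulr_ge0 ?sqr_ge0 ?ltW// sqrtrM ?sqr_ge0// sqrtr_sqr.
  by rewrite gtr0_norm// sqrtrV// ltW.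
have s3 : Num.sqrt (t * v / (1 + v)) = Num.sqrt t * Num.sqrt v / Num.sqrt (1 + v).
  by rewrite sqrtrM ?mulr_ge0 ?ltW// sqrtrM ?ltW// sqrtrV// ltW.
rewrite s2 s3.
have P2 : 2 * pi = Num.sqrt (2 * pi : R) ^+ 2.
  by rewrite sqr_sqrtr// mulr_ge0// pi_ge0.
have P0 : 0 < Num.sqrt (2 * pi : R) by rewrite sqrtr_gt0 mulr_gt0// pi_gt0.
have T0 : 0 < Num.sqrt t by rewrite sqrtr_gt0.
have S0 : 0 < Num.sqrt v by rewrite sqrtr_gt0.
have Y0 : 0 < Num.sqrt (1 + v) by rewrite sqrtr_gt0.
have tT : t = Num.sqrt t ^+ 2 by rewrite sqr_sqrtr// ltW.
have vS : v = Num.sqrt v ^+ 2 by rewrite sqr_sqrtr// ltW.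
have vY : 1 + v = Num.sqrt (1 + v) ^+ 2 by rewrite sqr_sqrtr// ltW.
move: (expR _) (expR _) => E1 E2.
rewrite [X in _ = s / (X * _) * _ * _]P2.
move: (Num.sqrt (2 * pi)) (Num.sqrt t) (Num.sqrt v) (Num.sqrt (1 + v))
  P0 T0 S0 Y0 tT vS vY {P2 s2 s3} => P T S Y P0 T0 S0 Y0 tT vS vY.
rewrite vY tT vS; field.
by rewrite !gt_eqF.
Qed.

(** A Brownian motion started at [0] reaches the level [A + s] by first hitting
    the line [y |-> s - (r / s) * y], at a time [y = s ^+ 2 / x], and then
    climbing the remaining [A + (r / s) * y] during the time [t - y]. *)
Lemma levy_first_line (r s A t : R) : 0 <= r -> 0 < s -> 0 < A -> 0 < t ->
  (\int[mu]_x (recip_inverse_gaussian r x * levy (A + r * s / x) (t - s ^+ 2 / x))%:E =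
   (levy (A + s) t)%:E)%E.
Proof.
move=> r0 s0 A0 t0; pose m := r * t / s + A.
have m0 : 0 < m by rewrite ltr_wpDl// divr_ge0 ?mulr_ge0// ltW.
have k0 : 0 < s ^+ 2 / t by rewrite divr_gt0// exprn_gt0.
pose C := s / (2 * pi * t ^+ 2) * expR (- ((A + s) ^+ 2 / (2 * t))).
have C0 : 0 <= C.
  by rewrite mulr_ge0 ?expR_ge0// divr_ge0 ?mulr_ge0 ?sqr_ge0 ?pi_ge0// ltW.
have f0 x : 0 <= recip_inverse_gaussian r x * levy (A + r * s / x) (t - s ^+ 2 / x).
  have [x0|x0] := ltP 0 x; last by rewrite /recip_inverse_gaussian ltNge x0 mul0r.
  apply: mulr_ge0; first exact: recip_inverse_gaussian_ge0.
  apply: levy_ge0; by rewrite addr_ge0 ?divr_ge0 ?mulr_ge0// ltW.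
rewrite (@ge0_integral_affine R (s ^+ 2 / t) (s ^+ 2 / t))//; first last.
- apply/measurable_EFinP; apply: measurable_funM.
    exact: measurable_fun_recip_inverse_gaussian.
  by apply: measurable_fun_levy; repeat measurability_step.
transitivity (\int[mu]_(v in `]0%R, +oo[) (C%:E * (ig_kernel A s m t v)%:E))%E.
  rewrite [RHS]integral_mkcond; apply: eq_integral => v _.
  rewrite patchE mem_setE in_itv/= andbT; case: ifPn => [v0|].
    rewrite -!EFinM; congr _%:E; exact: convolution_kernel.
  rewrite -leNgt => v0; rewrite -EFinM [X in X%:E](_ : _ = 0)//.
  set x := s ^+ 2 / t * v + s ^+ 2 / t.
  have [x0|x0] := ltP 0 x.
    rewrite [levy _ _](_ : _ = 0) ?mulr0//; rewrite /levy ltNge subr_le0.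
    by rewrite ler_pdivlMr// mulrC -ler_pdivlMr// gerDr mulr_ge0_le0// ltW.
  by rewrite /recip_inverse_gaussian ltNge x0 mul0r mulr0.
rewrite ge0_integralZl_EFin//; last 2 first.
- move=> v; rewrite /= in_itv/= andbT => v0; rewrite lee_fin.
  rewrite mulr_ge0 ?expR_ge0// divr_ge0 ?mulr_ge0 ?sqrtr_ge0 ?ltW//.
  by rewrite ltr_wpDl ?mulr_ge0 ?ltW.
- by apply/measurable_EFinP/measurable_funTS; rewrite /ig_kernel;
    repeat measurability_step.
rewrite integral_ig_kernel ?ltW// -EFinM; congr _%:E.
rewrite /levy t0 /C.
have P2 : 2 * pi = Num.sqrt (2 * pi : R) ^+ 2.
  by rewrite sqr_sqrtr// mulr_ge0// pi_ge0.
have P0 : 0 < Num.sqrt (2 * pi : R) by rewrite sqrtr_gt0 mulr_gt0// pi_gt0.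
have T0 : 0 < Num.sqrt t by rewrite sqrtr_gt0.
have tT : t = Num.sqrt t ^+ 2 by rewrite sqr_sqrtr// ltW.
rewrite [X in s / (X * _)]P2.
move: (expR _) => E1; move: (Num.sqrt (2 * pi)) (Num.sqrt t) P0 T0 tT {P2} => P T P0 T0 ->.
by field; rewrite !gt_eqF.
Qed.

End levy.

(** * Positive definite matrices and Schur complements *)

Section posdef_matrix.
Variable R : realType.

Definition quad n (M : 'M[R]_n) (x : 'rV[R]_n) : R := (x *m M *m x^T) 0 0.

Definition posdef_mx n (M : 'M[R]_n) : Prop :=
  forall x : 'rV[R]_n, x != 0 -> 0 < quad M x.

Lemma posdef_mx_unit n (M : 'M[R]_n) : posdef_mx M -> M \in unitmx.
Proof.
move=> pM; rewrite -row_free_unit -kermx_eq0; apply/eqP/row_matrixP => i.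
rewrite row0; apply/eqP; apply/negPn/negP => ki0.
have := pM _ ki0; rewrite /quad.
have -> : row i (kermx M) *m M = 0 by apply/sub_kermxP; exact: row_sub.
by rewrite mul0mx mxE ltxx.
Qed.

Lemma posdef_mx_congr n (L M : 'M[R]_n) : L \in unitmx ->
  posdef_mx (L *m M *m L^T) <-> posdef_mx M.
Proof.
move=> uL; have E x : quad (L *m M *m L^T) x = quad M (x *m L).
  by rewrite /quad trmx_mul !mulmxA.
split=> pM x x0; last first.
  rewrite E; apply: pM; apply: contraNneq x0 => xL0.
  by rewrite -(mulmxK uL x) xL0 mul0mx.
rewrite -(mulmxKV uL x) -E; apply: pM; apply: contraNneq x0 => xL0.
by rewrite -(mulmxKV uL x) xL0 mul0mx.
Qed.

Lemma quad_block_diag n1 n2 (D : 'M[R]_n1) (S : 'M[R]_n2) y z :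
  quad (block_mx D 0 0 S) (row_mx y z) = quad D y + quad S z.
Proof.
rewrite /quad mul_row_block !mulmx0 addr0 add0r tr_row_mx mul_row_col.
by rewrite mxE.
Qed.

Lemma posdef_mx_block_diag n1 n2 (D : 'M[R]_n1) (S : 'M[R]_n2) :
  posdef_mx (block_mx D 0 0 S) <-> posdef_mx D /\ posdef_mx S.
Proof.
have q0 n (N : 'M[R]_n) : quad N 0 = 0 by rewrite /quad !mul0mx mxE.
split=> [pM|[pD pS] x x0].
  split=> [y y0|z z0].
    have := pM (row_mx y 0); rewrite quad_block_diag q0 addr0; apply.
    by apply: contraNneq y0; rewrite -row_mx0 => /eq_row_mx[->].
  have := pM (row_mx 0 z); rewrite quad_block_diag q0 add0r; apply.
  by apply: contraNneq z0; rewrite -row_mx0 => /eq_row_mx[_ ->].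
rewrite -(hsubmxK x) quad_block_diag.
have [y0|y0] := eqVneq (lsubmx x) 0; last first.
  have [->|z0] := eqVneq (rsubmx x) 0; first by rewrite q0 addr0 pD.
  by rewrite addr_gt0 ?pD ?pS.
rewrite y0 q0 add0r; apply: pS; apply: contraNneq x0 => z0.
by rewrite -(hsubmxK x) y0 z0 row_mx0.
Qed.

Lemma posdef_mx_scalar (x : R) : posdef_mx (x%:M : 'M[R]_1) <-> 0 < x.
Proof.
have E (y : 'rV[R]_1) : quad x%:M y = x * y 0 0 ^+ 2.
  by rewrite /quad mul_mx_scalar -scalemxAl mxE mxE big_ord1 mxE expr2.
split=> [px|x0 y y0].
  have /px : (1%:M : 'rV[R]_1) != 0 by rewrite oner_neq0.
  by rewrite E mxE expr1n mulr1.
rewrite E mulr_gt0// lt_neqAle sqr_ge0 andbT eq_sym expf_eq0/=.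
apply: contraNneq y0 => y0; apply/eqP/matrixP => i j.
by rewrite !ord1 y0 mxE.
Qed.

Section schur.
Variables (n1 n2 : nat) (D : 'M[R]_n1) (Q : 'M[R]_(n1, n2)) (P : 'M[R]_n2).
Hypotheses (Dsym : D^T = D) (Dunit : D \in unitmx).

Let M := block_mx D Q Q^T P.
Definition schur := P - Q^T *m invmx D *m Q.
Let X := invmx D *m Q.
Let L := block_mx 1%:M 0 X^T 1%:M.

Let L_unit : L \in unitmx.
Proof. by rewrite unitmxE det_lblock !det1 mulr1 unitr1. Qed.

Let invD_sym : (invmx D)^T = invmx D.
Proof. by rewrite trmx_inv Dsym. Qed.

(** Block Gaussian elimination; positivity, the determinant and the inverse all
    follow from this congruence. *)
Lemma schur_factor : M = L *m block_mx D 0 0 schur *m L^T.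
Proof.
rewrite tr_block_mx !trmx1 trmx0 trmxK !mulmx_block !mul1mx !mulmx1 !mul0mx.
rewrite !(mulmx0, addr0, add0r) /X mulKVmx// trmx_mul invD_sym mulmxKV//.
by rewrite /schur mulmxA addrC subrK.
Qed.

Lemma schur_posdef : posdef_mx M <-> posdef_mx D /\ posdef_mx schur.
Proof. by rewrite schur_factor posdef_mx_congr//; exact: posdef_mx_block_diag. Qed.

Lemma schur_det : \det M = \det D * \det schur.
Proof.
by rewrite schur_factor !det_mulmx det_tr det_lblock !det1 det_ublock !mul1r mulr1.
Qed.

Lemma schur_inv : schur \in unitmx ->
  invmx M = block_mx (invmx D + X *m invmx schur *m X^T) (- (X *m invmx schur))
                     (- (invmx schur *m X^T)) (invmx schur).
Proof.
move=> uS; pose N : 'M[R]_(n1 + n2) :=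
  block_mx (invmx D + X *m invmx schur *m X^T) (- (X *m invmx schur))
           (- (invmx schur *m X^T)) (invmx schur).
have DX : D *m X = Q by rewrite /X mulKVmx.
have QX : Q^T *m X = P - schur by rewrite /schur /X mulmxA opprB addrC subrK.
have QD : Q^T *m invmx D = X^T by rewrite /X trmx_mul invD_sym.
have MN : M *m N = 1%:M.
  rewrite /M /N mulmx_block scalar_mx_block; congr block_mx.
  - rewrite mulmxDr mulmxV// mulmxN (mulmxA D (X *m _)) (mulmxA D X) DX.
    by rewrite (mulmxA Q) addrK.
  - by rewrite mulmxN (mulmxA D X) DX addrC subrr.
  - rewrite mulmxDr mulmxN QD (mulmxA Q^T (X *m _)) (mulmxA Q^T X) QX.
    rewrite (mulmxBl P schur) mulmxV// (mulmxBl _ 1%:M) mul1mx (mulmxA P).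
    by rewrite addrCA subrr addr0 subrr.
  - by rewrite mulmxN (mulmxA Q^T X) QX (mulmxBl P schur) mulmxV// opprB subrK.
have uM : M \in unitmx by case/mulmx1_unit: MN.
by rewrite -[RHS](mulKmx uM) MN mulmx1.
Qed.

Lemma schur_quad_inv (e1 : 'rV[R]_n1) (e2 : 'rV[R]_n2) : schur \in unitmx ->
  quad (invmx M) (row_mx e1 e2) =
  quad (invmx D) e1 + quad (invmx schur) (e2 - e1 *m invmx D *m Q).
Proof.
move=> uS; rewrite schur_inv// /quad.
rewrite mul_row_block tr_row_mx mul_row_col.
have -> : e1 *m invmx D *m Q = e1 *m X by rewrite mulmxA.
have -> : (e2 - e1 *m X)^T = e2^T - X^T *m e1^T by rewrite linearB/= trmx_mul.
have add00 (A B : 'M[R]_1) : (A + B) 0 0 = A 0 0 + B 0 0 by rewrite mxE.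
have opp00 (A : 'M[R]_1) : (- A) 0 0 = - A 0 0 by rewrite mxE.
rewrite !mulmxDr !mulmxDl !mulmxN !mulNmx !mulmxA !(add00, opp00).
ring.
Qed.

End schur.

Lemma posdef_mx_ulsubmx n1 n2 (D : 'M[R]_n1) (Q : 'M[R]_(n1, n2)) Q' (P : 'M[R]_n2) :
  posdef_mx (block_mx D Q Q' P) -> posdef_mx D.
Proof.
move=> pM y y0; have := pM (row_mx y 0).
rewrite /quad mul_row_block !mul0mx !addr0 tr_row_mx mul_row_col trmx0 mulmx0 addr0.
by apply; apply: contraNneq y0; rewrite -row_mx0 => /eq_row_mx[->].
Qed.

Lemma schur_scalarE n (x : R) (w : 'rV[R]_n) (P : 'M[R]_n) : x != 0 ->
  schur (x%:M : 'M[R]_1) (- w) P = P - x^-1 *: (w^T *m w).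
Proof.
move=> x0; have wN : (- w)^T = - w^T by rewrite linearN.
rewrite /schur invmx_scalar wN !mulNmx mulmxN opprK.
by rewrite mul_mx_scalar scalemxAl.
Qed.

(** The first pivot and the determinant of its Schur complement are both
    positive. *)
Lemma posdef_mx_det_gt0 n (M : 'M[R]_n) : M^T = M -> posdef_mx M -> 0 < \det M.
Proof.
elim: n M => [|n IH]; first by move=> M _ _; rewrite det_mx00.
rewrite -[n.+1]/(1 + n)%N => M; rewrite -(submxK M).
set D := ulsubmx _; set Q := ursubmx _; set Q' := dlsubmx _; set P := drsubmx _.
rewrite tr_block_mx => /eq_block_mx[Dsym _ QQ' Psym]; rewrite -QQ' => pM.
have pD := posdef_mx_ulsubmx pM.
have uD := posdef_mx_unit pD.
have [_ pS] := (schur_posdef _ _ Dsym uD).1 pM.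
rewrite (schur_det Q P Dsym uD) mulr_gt0//; last first.
  apply: IH => //; rewrite /schur linearB/= Psym !trmx_mul trmxK trmx_inv Dsym.
  by rewrite mulmxA.
by rewrite det_mx11; move: pD; rewrite {1}[D]mx11_scalar => /posdef_mx_scalar.
Qed.


(** * The density of the random potential *)

Definition mx_total n (M : 'M[R]_n) : R := \sum_i \sum_j M i j.

(** The density of the random potential, as a function of the matrix alone: the
    Schur complements at which it is evaluated do not come from a graph. *)
Definition potential_mx_density n (M : 'M[R]_n) : R :=
  if `[< posdef_mx M >] then
    Num.sqrt (2 / pi) ^+ n * expR (- (1 / 2) * mx_total M) * (Num.sqrt (\det M))^-1
  else 0.

Lemma potential_mx_density_ge0 n (M : 'M[R]_n) : 0 <= potential_mx_density M.
Proof.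
by rewrite /potential_mx_density; case: ifPn.
Qed.

Lemma potential_mx_density_gt0 n (M : 'M[R]_n) :
  M^T = M -> posdef_mx M -> 0 < potential_mx_density M.
Proof.
move=> Msym pM; rewrite /potential_mx_density asboolT//.
rewrite mulr_gt0 ?invr_gt0 ?sqrtr_gt0 ?posdef_mx_det_gt0//.
by rewrite mulr_gt0 ?expR_gt0// exprn_gt0// sqrtr_gt0 divr_gt0// pi_gt0.
Qed.

Lemma mx_total_block n1 n2 (D : 'M[R]_n1) (Q : 'M[R]_(n1, n2)) (P : 'M[R]_n2) :
  mx_total (block_mx D Q Q^T P) =
  mx_total D + 2 * (\sum_i \sum_j Q i j) + mx_total P.
Proof.
rewrite /mx_total big_split_ord/=.
under eq_bigr do (rewrite big_split_ord/=; under eq_bigr do rewrite block_mxEul;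
  under [X in _ + X]eq_bigr do rewrite block_mxEur).
under [X in _ + X]eq_bigr do (rewrite big_split_ord/=;
  under eq_bigr do rewrite block_mxEdl mxE;
  under [X in _ + X]eq_bigr do rewrite block_mxEdr).
rewrite !big_split/= [X in _ + (X + _)]exchange_big/=.
ring.
Qed.

Lemma mx_totalB n (A B : 'M[R]_n) : mx_total (A - B) = mx_total A - mx_total B.
Proof.
rewrite /mx_total -sumrB; apply: eq_bigr => i _; rewrite -sumrB.
by apply: eq_bigr => j _; rewrite !mxE.
Qed.

(** Elimination of a block: positivity and determinants are multiplicative,
    while the total of the Schur complement misses that of
    [Q^T *m invmx D *m Q], which is put back by the exponential. *)
Lemma potential_mx_density_block n1 n2 (D : 'M[R]_n1) (Q : 'M[R]_(n1, n2))
    (P : 'M[R]_n2) : D^T = D -> P^T = P -> posdef_mx D ->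
  potential_mx_density (block_mx D Q Q^T P) =
  potential_mx_density D *
  expR (- (\sum_i \sum_j Q i j) - 1 / 2 * mx_total (Q^T *m invmx D *m Q)) *
  potential_mx_density (schur D Q P).
Proof.
move=> Dsym Psym pD; have uD := posdef_mx_unit pD.
have sS : (schur D Q P)^T = schur D Q P.
  by rewrite /schur linearB/= Psym !trmx_mul trmxK trmx_inv Dsym mulmxA.
rewrite /potential_mx_density (asboolT pD).
have [pS|pS] := pselect (posdef_mx (schur D Q P)); last first.
  rewrite (asboolF pS) mulr0 asboolF// => pM; apply: pS.
  by have [] := (schur_posdef Q P Dsym uD).1 pM.
rewrite (asboolT pS) asboolT; last by apply/(schur_posdef Q P Dsym uD).
have dD := ltW (posdef_mx_det_gt0 Dsym pD).
rewrite (schur_det Q P Dsym uD) (sqrtrM _ dD) invfM exprD.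
rewrite mx_total_block /schur mx_totalB.
set E := mx_total (_ *m _); set q := \sum_i _.
set E1 := expR _; rewrite (_ : E1 = expR (- (1 / 2) * mx_total D) *
  expR (- q - 1 / 2 * E) * expR (- (1 / 2) * (mx_total P - E))); first by ring.
by rewrite -!expRD; congr expR; field.
Qed.

Lemma potential_mx_density_scalar (x : R) :
  potential_mx_density (x%:M : 'M[R]_1) = 2 * recip_inverse_gaussian 0 x.
Proof.
have xE : `[< posdef_mx (x%:M : 'M[R]_1) >] = (0 < x).
  by apply/asboolP/idP => /posdef_mx_scalar.
rewrite /potential_mx_density /recip_inverse_gaussian xE; case: ifPn => x0; last by rewrite mulr0.
rewrite det_scalar1 expr1 /mx_total !big_ord1 mxE mulr1n.
have P2 : Num.sqrt (2 / pi) = 2 / Num.sqrt (2 * pi : R).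
  apply/eqP; rewrite -(@eqrXn2 _ 2)// ?sqrtr_ge0//.
    rewrite sqr_sqrtr ?divr_ge0 ?pi_ge0// expr_div_n sqr_sqrtr ?mulr_ge0 ?pi_ge0//.
    by rewrite expr2 -mulf_div divff ?mul1r.
rewrite P2 expr0n/= mul0r mulr0 addr0 subr0 invfM.
by rewrite [in expR _](_ : _ * x = - (x / 2)); [ring|field].
Qed.

Lemma potential_mx_density_step n (x : R) (w : 'rV[R]_n) (P : 'M[R]_n) : P^T = P ->
  potential_mx_density (block_mx (x%:M : 'M[R]_1) (- w) (- w)^T P) =
  2 * recip_inverse_gaussian (\sum_j w 0 j) x *
  potential_mx_density (P - x^-1 *: (w^T *m w)).
Proof.
move=> Psym; have [x0|x0] := ltP 0 x; last first.
  rewrite {1}/potential_mx_density asboolF; last first.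
    by move=> /posdef_mx_ulsubmx/posdef_mx_scalar; rewrite ltNge x0.
  by rewrite /recip_inverse_gaussian ltNge x0 mulr0 mul0r.
rewrite potential_mx_density_block ?tr_scalar_mx//; last exact/posdef_mx_scalar.
rewrite schur_scalarE ?gt_eqF// potential_mx_density_scalar; congr (_ * _).
rewrite /recip_inverse_gaussian x0 -!mulrA; do 2 congr (_ * _).
have -> : \sum_i \sum_j (- w) i j = - \sum_j w 0 j.
  by rewrite big_ord1 -sumrN; apply: eq_bigr => j _; rewrite mxE.
have -> : mx_total ((- w)^T *m invmx (x%:M) *m (- w)) = (\sum_j w 0 j) ^+ 2 / x.
  have -> : (- w)^T = - w^T by rewrite linearN.
  rewrite invmx_scalar !mulNmx mulmxN opprK mul_mx_scalar -scalemxAl /mx_total.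
  rewrite expr2 mulr_suml mulr_suml; apply: eq_bigr => i _.
  rewrite mulr_sumr mulr_suml; apply: eq_bigr => j _.
  by rewrite !mxE big_ord1 !mxE mulrC.
by rewrite -expRD; congr expR; field; rewrite gt_eqF.
Qed.

End posdef_matrix.

Section measurable_matrices.
Context d (B : measurableType d) (R : realType).

Definition measurable_mx m n (M : B -> 'M[R]_(m, n)) : Prop :=
  forall i j, measurable_fun setT (fun b => M b i j).

Lemma measurable_mx_mul m n p (M : B -> 'M[R]_(m, n)) (N : B -> 'M[R]_(n, p)) :
  measurable_mx M -> measurable_mx N -> measurable_mx (fun b => M b *m N b).
Proof.
move=> mM mN i j; under eq_fun do rewrite mxE.
by apply: measurable_sum => k; apply: measurable_funM.
Qed.

Lemma measurable_det n (M : B -> 'M[R]_n) :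
  measurable_mx M -> measurable_fun setT (fun b => \det (M b)).
Proof.
move=> mM; rewrite /determinant; apply: measurable_sum => s.
apply: measurable_funM; first exact: measurable_cst.
by apply: measurable_prod => i _; exact: mM.
Qed.

(** Cramer's formula; a singular matrix is its own [invmx]. *)
Lemma measurable_invmx n (M : B -> 'M[R]_n) :
  measurable_mx M -> measurable_mx (fun b => invmx (M b)).
Proof.
move=> mM i j.
rewrite (_ : (fun b => _) = fun b => if \det (M b) == 0 then M b i j else
   (\det (M b))^-1 * ((-1) ^+ (j + i) * \det (row' j (col' i (M b))))).
  apply: measurable_fun_ifT; first exact: measurable_fun_eqr (measurable_det mM) _.
    exact: mM.
  apply: measurable_funM; first exact/measurable_funV/measurable_det.
  apply: measurable_funM; first exact: measurable_cst.
  by apply: measurable_det => k l; under eq_fun do rewrite !mxE; exact: mM.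
apply/funext => b; rewrite /invmx unitmxE unitfE; case: eqP => //= _.
by rewrite !mxE.
Qed.

Lemma measurable_mx_total n (M : B -> 'M[R]_n) :
  measurable_mx M -> measurable_fun setT (fun b => mx_total (M b)).
Proof.
by move=> mM; apply: measurable_sum => i; apply: measurable_sum => j; exact: mM.
Qed.

(** Positivity is a condition on the first pivot and, recursively, on its Schur
    complement, which is a measurable function of the matrix. *)
Lemma measurable_posdef_mx n (M : B -> 'M[R]_n) : measurable_mx M ->
  (forall b, (M b)^T = M b) ->
  measurable_fun setT (fun b => `[< posdef_mx (M b) >]).
Proof.
elim: n M => [|n IH].
  move=> M _ _; rewrite (_ : (fun b => _) = cst true); first exact: measurable_cst.
  apply/funext => b; apply/asboolP => x; rewrite (_ : x = 0) ?eqxx//.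
  by apply/matrixP => i [].
rewrite -[n.+1]/(1 + n)%N => M mM sM.
pose S b := schur (ulsubmx (M b)) (ursubmx (M b)) (drsubmx (M b)).
have sub b : [/\ M b = block_mx (ulsubmx (M b)) (ursubmx (M b)) (ursubmx (M b))^T
    (drsubmx (M b)), (ulsubmx (M b))^T = ulsubmx (M b) & (drsubmx (M b))^T = drsubmx (M b)].
  by split; rewrite ?trmx_ursub ?trmx_ulsub ?trmx_drsub sM// submxK.
rewrite (_ : (fun b => _) = fun b => if 0 < M b 0 0 then `[< posdef_mx (S b) >] else false).
  apply: measurable_fun_ifT; last exact: measurable_cst.
    by apply: measurable_fun_ltr; [exact: measurable_cst|exact: mM].
  apply: IH => [i j|b].
    rewrite /S /schur; under eq_fun do rewrite mxE [X in _ + X]mxE.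
    apply: measurable_funB.
      by under eq_fun do rewrite !mxE; exact: mM.
    apply: measurable_mx_mul => [k l|k l].
      apply: measurable_mx_mul => [k' l'|].
        by under eq_fun do rewrite !mxE; exact: mM.
      apply: measurable_invmx => k' l'.
      by under eq_fun do rewrite !mxE; exact: mM.
    by under eq_fun do rewrite !mxE; exact: mM.
  have [_ sD sP] := sub b.
  by rewrite /S /schur linearB/= sP !trmx_mul trmxK trmx_inv sD mulmxA.
apply/funext => b; have [ME sD sP] := sub b.
have DE : ulsubmx (M b) = (M b 0 0)%:M.
  by rewrite [LHS]mx11_scalar !mxE; congr (M b _ _)%:M; apply/val_inj.
case: ifPn => M0; last first.
  rewrite asboolF// ME DE => /posdef_mx_ulsubmx/posdef_mx_scalar.
  exact/negP.
have pD : posdef_mx (ulsubmx (M b)) by rewrite DE; exact/posdef_mx_scalar.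
have H := schur_posdef (ursubmx (M b)) (drsubmx (M b)) sD (posdef_mx_unit pD).
rewrite -ME in H; apply/asboolP/asboolP; first by case/H.
by move=> pS; apply/H.
Qed.

Lemma measurable_potential_mx_density n (M : B -> 'M[R]_n) : measurable_mx M ->
  (forall b, (M b)^T = M b) ->
  measurable_fun setT (fun b => potential_mx_density (M b)).
Proof.
move=> mM sM; apply: measurable_fun_ifT; last exact: measurable_cst.
  exact: measurable_posdef_mx.
apply: measurable_funM; last exact/measurable_funV/measurable_fun_sqrt/measurable_det.
apply: measurable_funM; first exact: measurable_cst.
apply: measurable_fun_expR; apply: measurable_funM; first exact: measurable_cst.
exact: measurable_mx_total.
Qed.

End measurable_matrices.

(** * Lebesgue measure on tuples and finite functions *)

Section lebesgue_tuple_theory.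
Variable R : realType.
Local Notation mR := (measurableTypeR R).
Local Open Scope ereal_scope.

Lemma ge0_integral_lebesgue_tuple0 (F : 0.-tuple mR -> \bar R) :
  measurable_fun setT F -> (forall t, 0 <= F t) ->
  \int[lebesgue_tuple R 0]_t F t = F [tuple].
Proof. by move=> mF F0; rewrite /= integral_dirac// diracT mul1e. Qed.

Lemma ge0_integral_lebesgue_tupleS n (F : n.+1.-tuple mR -> \bar R) :
  measurable_fun setT F -> (forall t, 0 <= F t) ->
  \int[lebesgue_tuple R n.+1]_t F t =
  \int[@lebesgue_measure R]_x \int[lebesgue_tuple R n]_t F [tuple of x :: t].
Proof.
move=> mF F0.
pose c (p : mR * n.-tuple mR) : n.+1.-tuple mR := [tuple of p.1 :: p.2].
have mc : measurable_fun setT c by exact: measurable_cons.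
pose cmixin := isMeasurableFun.Build _ _ _ _ c mc.
pose c' : {mfun (mR * n.-tuple mR)%type >-> n.+1.-tuple mR} := HB.pack c cmixin.
transitivity (\int[pushforward (@lebesgue_measure R \x lebesgue_tuple R n) c']_t F t).
  exact: eq_measure_integral.
rewrite (@ge0_integral_pushforward _ _ _ _ _ c' mc _ setT F)// preimage_setT.
apply: (fubini_tonelli1 (F \o c)) => [|p]; last exact: F0.
exact: measurableT_comp.
Qed.

Lemma ge0_integral_lebesgue_tuple1 (F : 1.-tuple mR -> \bar R) :
  measurable_fun setT F -> (forall t, 0 <= F t) ->
  \int[lebesgue_tuple R 1]_t F t = \int[@lebesgue_measure R]_x F [tuple x].
Proof.
move=> mF F0; rewrite ge0_integral_lebesgue_tupleS//.
apply: eq_integral => x _; rewrite ge0_integral_lebesgue_tuple0//.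
apply: measurableT_comp mF _; apply: measurable_cons => //.
Qed.

Definition tuple_box n (A : 'I_n -> set mR) : set (n.-tuple mR) :=
  [set t | forall i, A i (tnth t i)].

Lemma measurable_tuple_box n (A : 'I_n -> set mR) :
  (forall i, measurable (A i)) -> measurable (tuple_box A).
Proof.
move=> mA; rewrite (_ : tuple_box A =
    \bigcap_(i in [set: 'I_n]) ((@tnth n mR)^~ i @^-1` A i)).
  apply: fin_bigcap_measurable => // i _.
  by rewrite -[X in measurable X]setTI; exact: measurable_tnth.
by apply/seteqP; split => [t At i _|t At i]; exact: At.
Qed.

Lemma lebesgue_tuple_box n (A : 'I_n -> set mR) :
  (forall i, measurable (A i)) ->
  lebesgue_tuple R n (tuple_box A) = \prod_(i < n) @lebesgue_measure R (A i).
Proof.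
elim: n A => [|n IH] A mA.
  by rewrite big_ord0 /= diracE mem_set// => -[].
rewrite big_ord_recl -IH//= /lebesgue_cons /pushforward.
rewrite -product_measure1E//; last exact: measurable_tuple_box.
congr (_ _); apply/seteqP; split => [[x t] /= At|[x t] [/= Ax At]].
  split=> [|i]; first exact: (At ord0).
  by have := At (lift ord0 i); rewrite tnthS.
by move=> i; have [j ->|->] := unliftP ord0 i; [rewrite tnthS; exact: At|].
Qed.

End lebesgue_tuple_theory.

Section lebesgue_ffun_theory.
Variables (R : realType) (I : finType).
Local Notation mR := (measurableTypeR R).
Local Open Scope ereal_scope.

Definition ffun_box (A : I -> set R) : set {ffun I -> R} :=
  [set f | forall i, A i (f i)].

Lemma measurable_ffun_eval (i : I) :
  measurable_fun setT (fun f : {ffun I -> R} => f i).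
Proof.
move=> _ Y mY; apply: sub_sigma_algebra; exists i => //.
by exists Y.
Qed.

Lemma measurable_ffun_box (A : I -> set R) :
  (forall i, measurable (A i)) -> measurable (ffun_box A).
Proof.
move=> mA; rewrite (_ : ffun_box A =
    \bigcap_(i in [set: I]) ((fun f : {ffun I -> R} => f i) @^-1` A i)).
  apply: fin_bigcap_measurable => // i _.
  by rewrite -[X in measurable X]setTI; exact: measurable_ffun_eval.
by apply/seteqP; split => [t At i _|t At i]; exact: At.
Qed.

Lemma lebesgue_ffun_box (A : I -> set R) :
  (forall i, measurable (A i)) ->
  lebesgue_ffun (ffun_box A) = \prod_(i : I) @lebesgue_measure R (A i).
Proof.
move=> mA; rewrite /lebesgue_ffun /pushforward.
rewrite (_ : _ @^-1` _ = tuple_box (fun j : 'I_#|I| => A (enum_val j))).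
  rewrite (lebesgue_tuple_box (fun j => mA (enum_val j))).
  rewrite [RHS](reindex (fun j : 'I_#|I| => enum_val j))//.
  by exists enum_rank => i _; rewrite ?enum_valK ?enum_rankK.
apply/seteqP; split => t /= At i.
  by have := At (enum_val i); rewrite ffunE enum_valK.
by rewrite ffunE; have := At (enum_rank i); rewrite enum_rankK.
Qed.

(** Boxes generate the sigma-algebra and are stable by intersection. *)
Lemma lebesgue_ffun_unique (m : {measure set {ffun I -> R} -> \bar R}) :
  (forall A : I -> set R, (forall i, measurable (A i)) ->
    m (ffun_box A) = \prod_(i : I) @lebesgue_measure R (A i)) ->
  forall X, measurable X -> lebesgue_ffun X = m X.
Proof.
move=> mbox.
pose G : set (set {ffun I -> R}) :=
  [set ffun_box A | A in [set A : I -> set R | forall i, measurable (A i)]].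
apply: (@measure_unique _ R {ffun I -> R} G
  (fun n => ffun_box (fun=> `[(- n%:R)%R, n%:R%R]%classic))).
- apply/seteqP; split.
    apply: smallest_sub; first exact: smallest_sigma_algebra.
    move=> _ [i _ [B mB <-]]; apply: sub_sigma_algebra.
    exists (fun j => if j == i then B else setT).
      by move=> j; case: ifP.
    apply/seteqP; split => f /=; first by move=> /(_ i); rewrite eqxx.
    by move=> [_ Bf] j; case: eqP => // ->.
  apply: smallest_sub; first exact: sigma_algebra_measurable.
  by move=> _ [A mA <-]; exact: measurable_ffun_box.
- move=> _ _ [A mA <-] [B mB <-]; exists (fun i => A i `&` B i).
    by move=> i; apply: measurableI; [exact: mA|exact: mB].
  apply/seteqP; split => f /=; first by move=> ABf; split => i; have [] := ABf i.
  by move=> [Af Bf] i; split; [exact: Af|exact: Bf].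
- by move=> n; exists (fun=> `[(- n%:R)%R, n%:R%R]%classic) => // i; exact: measurable_itv.
- apply/seteqP; split => // f _.
  exists (\max_(i : I) (Num.truncn `|f i|).+1)%N => // i /=.
  rewrite in_itv/= -ler_norml (le_trans (ltW (truncnS_gt _)))// ler_nat.
  exact: leq_bigmax.
- by move=> _ [A mA <-]; rewrite mbox//; exact: lebesgue_ffun_box.
- move=> n; have mI (i : I) : measurable (`[(- n%:R)%R, n%:R%R]%classic : set R).
    exact: measurable_itv.
  have E := lebesgue_ffun_box mI.
  have : \prod_(i : I) @lebesgue_measure R `[(- n%:R)%R, n%:R%R] < +oo.
    rewrite ltey_eq prode_fin_num// => i _.
    by rewrite lebesgue_measure_itv/=; case: ifP.
  by rewrite -E.
Qed.

(** Fubini for an arbitrary splitting of the coordinates: the values on boxes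
    show that the measure does not depend on how [I] is enumerated. *)
Lemma ge0_integral_lebesgue_ffun n1 n2 (pos : I -> 'I_n1 + 'I_n2)
    (F : {ffun I -> R} -> \bar R) :
  bijective pos -> measurable_fun setT F -> (forall f, 0 <= F f) ->
  \int[@lebesgue_ffun R I]_f F f =
  \int[lebesgue_tuple R n1]_s \int[lebesgue_tuple R n2]_t
    F [ffun i => match pos i with inl j => tnth s j | inr j => tnth t j end].
Proof.
move=> [inv posK invK] mF F0.
pose c (p : n1.-tuple mR * n2.-tuple mR) : {ffun I -> R} :=
  [ffun i => match pos i with inl j => tnth p.1 j | inr j => tnth p.2 j end].
have mc : measurable_fun setT c.
  apply: measurable_ffunP => i.
  rewrite (_ : (fun p => _) = fun p => match pos i with
    inl j => tnth p.1 j | inr j => tnth p.2 j end); last by apply/funext => p; rewrite ffunE.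
  by case: (pos i) => j; [exact: (measurableT_comp (measurable_tnth j) measurable_fst)
    |exact: (measurableT_comp (measurable_tnth j) measurable_snd)].
pose cmixin := isMeasurableFun.Build _ _ _ _ c mc.
pose c' : {mfun (n1.-tuple mR * n2.-tuple mR)%type >-> {ffun I -> R}} := HB.pack c cmixin.
transitivity (\int[pushforward (lebesgue_tuple R n1 \x lebesgue_tuple R n2) c']_t F t).
  apply: eq_measure_integral => A mA _; apply: lebesgue_ffun_unique => // {mA}A mA.
  rewrite -[LHS]/((lebesgue_tuple R n1 \x lebesgue_tuple R n2) (c @^-1` ffun_box A)).
  have -> : c @^-1` ffun_box A = tuple_box (fun j => A (inv (inl j))) `*`
      tuple_box (fun j => A (inv (inr j))).
    apply/seteqP; split => [[s t] /= Ast|[s t] [/= As At] i].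
      by split=> j; [have := Ast (inv (inl j))|have := Ast (inv (inr j))]; rewrite ffunE invK.
    rewrite ffunE; case E: (pos i) => [j|j] /=.
      by have := As j; rewrite -E posK.
    by have := At j; rewrite -E posK.
  have mA1 j : measurable (A (inv (inl j))) by exact: mA.
  have mA2 j : measurable (A (inv (inr j))) by exact: mA.
  rewrite product_measure1E; [|exact: measurable_tuple_box|exact: measurable_tuple_box].
  rewrite [RHS](reindex inv); last by exists pos => ? _; rewrite ?posK ?invK.
  rewrite big_sumType/=; congr (_ * _); exact: lebesgue_tuple_box.
rewrite (@ge0_integral_pushforward _ _ _ _ _ c' mc _ setT F)// preimage_setT.
apply: (fubini_tonelli1 (F \o c)) => [|p]; last exact: F0.
exact: measurableT_comp.
Qed.

End lebesgue_ffun_theory.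

(** * Sampling a potential with prescribed total Green weight *)

Section potential_matrix.
Variable R : realType.
Local Notation mR := (measurableTypeR R).

(** The diagonal of [W] may be non-zero: eliminating a vertex turns the weights
    into those of [pivot_weight], where it does not vanish in general. *)
Definition pot_mx n (W : 'M[R]_n) (beta : n.-tuple mR) : 'M[R]_n :=
  \matrix_(i, j) ((if i == j then 2 * tnth beta i else 0) - W i j).

Lemma pot_mx_sym n (W : 'M[R]_n) beta : W^T = W -> (pot_mx W beta)^T = pot_mx W beta.
Proof.
move=> sW; apply/matrixP => i j; rewrite !mxE -{1}sW mxE eq_sym.
by case: eqP => [->|].
Qed.

Lemma measurable_pot_mx d (B : measurableType d) n (W : B -> 'M[R]_n)
    (beta : B -> n.-tuple mR) :
  measurable_mx W -> measurable_fun setT beta ->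
  measurable_mx (fun b => pot_mx (W b) (beta b)).
Proof.
move=> mW mbeta i j; under eq_fun do rewrite mxE.
apply: measurable_funB; last exact: mW.
have [ij|ij] := eqVneq i j; last exact: measurable_cst.
apply: measurable_funM; first exact: measurable_cst.
exact: measurableT_comp (measurable_tnth i) mbeta.
Qed.

Lemma measurable_quad d (B : measurableType d) n (M : B -> 'M[R]_n)
    (e : B -> 'rV[R]_n) :
  measurable_mx M -> measurable_mx e ->
  measurable_fun setT (fun b => quad (M b) (e b)).
Proof.
move=> mM me; apply: measurable_mx_mul; first exact: measurable_mx_mul.
by move=> i j; under eq_fun do rewrite mxE; exact: me.
Qed.

Section one_vertex.
Variables (n : nat) (W : 'M[R]_(1 + n)).
Hypothesis Wsym : W^T = W.

Lemma pot_mx_cons (a : mR) (beta : n.-tuple mR) :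
  pot_mx W [tuple of a :: beta] =
  block_mx (2 * a - W 0 0)%:M (- ursubmx W) (- ursubmx W)^T (pot_mx (drsubmx W) beta).
Proof.
have l0 (i : 'I_1) : lshift n i = ord0 by apply/val_inj; rewrite ord1.
have tr (i : 'I_n) : tnth [tuple of a :: beta] (rshift 1 i) = tnth beta i.
  by rewrite (_ : rshift 1 i = lift ord0 i) ?tnthS//; apply/val_inj.
rewrite -[LHS]submxK; congr block_mx; apply/matrixP => i j; rewrite !mxE.
- by rewrite !l0 !ord1 !eqxx mulr1n.
- by rewrite eq_lrshift sub0r.
- by rewrite eq_rlshift sub0r -{1}Wsym mxE.
- by rewrite eq_rshift tr.
Qed.

Let r := \sum_j ursubmx W 0 j.

(** The weights, and below the vector, left after the elimination of the first
    vertex with pivot [x]. The absolute value keeps them non-negative for every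
    real [x], as they will be parameters of another sampler; only [x > 0]
    matters. *)
Definition pivot_weight (x : R) : 'M[R]_n :=
  drsubmx W + `|x|^-1 *: ((ursubmx W)^T *m ursubmx W).

Definition pivot_vector (e : 'rV[R]_(1 + n)) (x : R) : 'rV[R]_n :=
  rsubmx e + (e 0 0 * `|x|^-1) *: ursubmx W.

Let drW_sym : (drsubmx W)^T = drsubmx W.
Proof. by rewrite trmx_drsub Wsym. Qed.

Lemma pivot_weight_sym x : (pivot_weight x)^T = pivot_weight x.
Proof.
by rewrite /pivot_weight linearD/= linearZ/= trmx_mul trmxK drW_sym.
Qed.

Let pivot_schur (x : R) (beta : n.-tuple mR) : 0 < x ->
  pot_mx (drsubmx W) beta - x^-1 *: ((ursubmx W)^T *m ursubmx W) =
  pot_mx (pivot_weight x) beta.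
Proof.
move=> x0; apply/matrixP => i j; rewrite /pivot_weight gtr0_norm// !mxE.
by rewrite opprD addrA.
Qed.

(** The potential of the first vertex is expressed through its pivot
    [x = 2 a - W 0 0], whose law depends on the graph only through the sum [r]
    of the weights at that vertex. *)
Lemma potential_density_cons (x : R) (beta : n.-tuple mR) :
  potential_mx_density (pot_mx W [tuple of (2^-1 * x + 2^-1 * W 0 0 : mR) :: beta]) =
  2 * recip_inverse_gaussian r x * potential_mx_density (pot_mx (pivot_weight x) beta).
Proof.
rewrite pot_mx_cons (_ : 2 * _ - _ = x); last by field.
rewrite potential_mx_density_step; last exact: pot_mx_sym.
have [x0|x0] := ltP 0 x; first by rewrite pivot_schur.
by rewrite /recip_inverse_gaussian ltNge x0 mulr0 !mul0r.
Qed.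

Lemma green_weight_cons (e : 'rV[R]_(1 + n)) (x : R) (beta : n.-tuple mR) :
  0 < x -> posdef_mx (pot_mx (pivot_weight x) beta) ->
  quad (invmx (pot_mx W [tuple of (2^-1 * x + 2^-1 * W 0 0 : mR) :: beta])) e =
  e 0 0 ^+ 2 / x +
  quad (invmx (pot_mx (pivot_weight x) beta)) (pivot_vector e x).
Proof.
move=> x0 pS; rewrite pot_mx_cons (_ : 2 * _ - _ = x); last by field.
rewrite -(pivot_schur beta x0) in pS *.
have ux : (x%:M : 'M[R]_1) \in unitmx.
  by rewrite unitmxE det_scalar1 unitfE gt_eqF.
have xn0 : x != 0 by rewrite gt_eqF.
have S := schur_scalarE (ursubmx W) (pot_mx (drsubmx W) beta) xn0.
rewrite -{1}(hsubmxK e) schur_quad_inv ?tr_scalar_mx//; last first.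
  by rewrite S; exact: posdef_mx_unit.
rewrite S; congr (_ + _).
  rewrite /quad invmx_scalar mul_mx_scalar -scalemxAl mxE mxE big_ord1 !mxE.
  rewrite (_ : lshift n ord0 = 0); last exact/val_inj.
  by rewrite mulrC expr2.
rewrite /pivot_vector gtr0_norm// invmx_scalar mul_mx_scalar mulmxN opprK -scalemxAl.
congr (quad _ (_ + _)).
apply/rowP => j; rewrite !mxE big_ord1 !mxE.
rewrite (_ : lshift n ord0 = 0); last exact/val_inj.
by rewrite mulrA [x^-1 * _]mulrC.
Qed.

End one_vertex.

End potential_matrix.

Section sampler.
Variable R : realType.
Local Notation mR := (measurableTypeR R).
Local Notation mu := (@lebesgue_measure R).

(** For each value of the parameter [b], the quadratic form of the Green matrix
    along [e b] has a Levy density, and given its value [t] the potential is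
    distributed as [Phi] of [b], [t] and a noise [xi]. The parameter is needed
    for the induction: the weights on the remaining vertices depend on the
    first pivot, and sampling must be measurable in it. *)
Definition sampler_spec n d (B : measurableType d) (W : B -> 'M[R]_n)
    (e : B -> 'rV[R]_n) : Prop :=
  exists (d' : measure_display) (Xi : measurableType d') (Q : probability Xi R)
      (Phi : (B * mR) * Xi -> n.-tuple mR),
    measurable_fun setT Phi /\
    forall b (Psi : mR * n.-tuple mR -> \bar R), measurable_fun setT Psi ->
      (forall p, 0 <= Psi p)%E ->
      (\int[lebesgue_tuple R n]_beta
        ((potential_mx_density (pot_mx (W b) beta))%:E *
         Psi (quad (invmx (pot_mx (W b) beta)) (e b), beta)) =
      \int[mu]_t ((levy (\sum_j e b 0 j)%R t)%:E *
                  \int[Q]_xi Psi (t, Phi ((b, t), xi))))%E.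

Lemma measurable_sampler_integrand n (W : 'M[R]_n) (e : 'rV[R]_n)
    (Psi : mR * n.-tuple mR -> \bar R) : W^T = W ->
  measurable_fun setT Psi ->
  measurable_fun setT (fun beta : n.-tuple mR =>
    ((potential_mx_density (pot_mx W beta))%:E *
     Psi (quad (invmx (pot_mx W beta)) e, beta))%E).
Proof.
move=> sW mPsi.
have mpot : measurable_mx (fun beta : n.-tuple mR => pot_mx W beta).
  by apply: (@measurable_pot_mx R _ _ n (cst W) id) => // i j.
apply: emeasurable_funM.
  apply/measurable_EFinP; apply: measurable_potential_mx_density => // beta.
  exact: pot_mx_sym.
apply: (measurableT_comp mPsi); apply: measurable_fun_pair => //.
by apply: measurable_quad => //; exact: measurable_invmx.
Qed.

(** With one vertex [t = e ^ 2 / x] determines the pivot [x], which is the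
    square of a standard normal variable; the inversion turns its density into
    a Levy density and there is nothing left to sample. *)
Lemma sampler1 d (B : measurableType d) (W : B -> 'M[R]_1) (e : B -> 'rV[R]_1) :
  measurable_mx W -> measurable_mx e -> (forall b j, (0 < e b 0 j)%R) ->
  sampler_spec W e.
Proof.
move=> mW me e0; have [Q _] := uniform_noise R.
exists _, mR, Q, (fun p => [tuple of
  (2^-1 * (e p.1.1 0 0 ^+ 2 / p.1.2) + 2^-1 * W p.1.1 0 0 : mR)%R :: [tuple]]).
split.
  apply: measurable_cons => //.
  have m11 : measurable_fun setT (fun p : (B * mR) * mR => p.1.1).
    exact: measurableT_comp measurable_fst measurable_fst.
  have m12 : measurable_fun setT (fun p : (B * mR) * mR => p.1.2).
    exact: measurableT_comp measurable_snd measurable_fst.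
  have meb : measurable_fun setT (fun p : (B * mR) * mR => e p.1.1 0 0).
    exact: measurableT_comp (me 0 0) m11.
  have mWb : measurable_fun setT (fun p : (B * mR) * mR => W p.1.1 0 0).
    exact: measurableT_comp (mW 0 0) m11.
  by repeat measurability_step.
move=> b Psi mPsi Psi0; set s := e b 0 0; have s0 : (0 < s)%R by exact: e0.
have sW : (W b)^T = W b by apply/matrixP => i j; rewrite mxE !ord1.
have potE (a : mR) : pot_mx (W b) [tuple a] = (2 * a - W b 0 0)%:M.
  by apply/matrixP => i j; rewrite !mxE !ord1 eqxx mulr1n (tnth_nth 0%R).
pose F (beta : 1.-tuple mR) := ((potential_mx_density (pot_mx (W b) beta))%:E *
  Psi (quad (invmx (pot_mx (W b) beta)) (e b), beta))%E.
have mF : measurable_fun setT F by exact: measurable_sampler_integrand.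
have F0 beta : (0 <= F beta)%E.
  by rewrite mule_ge0// lee_fin potential_mx_density_ge0.
have mF1 : measurable_fun setT (fun x : mR => F [tuple x]).
  by apply: (measurableT_comp mF); exact: measurable_cons.
rewrite [LHS](ge0_integral_lebesgue_tuple1 mF F0).
rewrite [LHS](@ge0_integral_affine R 2^-1 (2^-1 * W b 0 0)%R (fun x => F [tuple x]))//.
pose a x := (2^-1 * x + 2^-1 * W b 0 0)%R.
have mh : measurable_fun setT (fun x : mR => Psi ((s ^+ 2 / x)%R, [tuple a x : mR])).
  apply: (measurableT_comp mPsi); apply: measurable_fun_pair.
    by repeat measurability_step.
  apply: measurable_cons => //; rewrite /a; repeat measurability_step.
have mig : measurable_fun setT (fun x : mR => recip_inverse_gaussian 0 x).
  by apply: measurable_fun_recip_inverse_gaussian => //; exact: measurable_cst.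
transitivity (\int[mu]_x ((0 < x)%R%:R%:E *
   ((recip_inverse_gaussian 0 x)%:E * Psi ((s ^+ 2 / x)%R, [tuple a x : mR]))))%E.
  apply: eq_integral => x _; rewrite /F potE (_ : 2 * _ - _ = x)%R; last by field.
  rewrite potential_mx_density_scalar muleA -EFinM mulrA mulVf// mul1r.
  have [x0|x0] := ltP 0%R x; last by rewrite /recip_inverse_gaussian ltNge x0 !mul0e.
  rewrite mul1e invmx_scalar; congr (_ * Psi (_, _))%E.
  rewrite /quad mul_mx_scalar -scalemxAl mxE mxE big_ord1 !mxE mulrC.
  by rewrite -expr2.
rewrite (@ge0_integral_inversion R (s ^+ 2))//; last 3 first.
- by rewrite exprn_gt0.
- by apply: emeasurable_funM => //; exact/measurable_EFinP.
- by move=> x; rewrite mule_ge0// lee_fin recip_inverse_gaussian_ge0.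
apply: eq_integral => t _; rewrite muleA -EFinM.
have [t0|t0] := ltP 0%R t; last first.
  by rewrite mul0r /levy ltNge t0 !mul0e.
rewrite /= integral_cst//= probability_setT mule1; congr (_%:E * Psi (_, _))%E.
  rewrite big_ord1 -/s /levy /recip_inverse_gaussian t0 divr_gt0 ?exprn_gt0//.
  rewrite expr0n/= mul0r addr0 mulr0 subr0.
  have -> : (s ^+ 2 / t / 2 = s ^+ 2 / (2 * t))%R by field; rewrite gt_eqF.
  rewrite mulrA; congr (_ * _)%R.
  have T0 : (0 < Num.sqrt t)%R by rewrite sqrtr_gt0.
  have P0 : (0 < Num.sqrt (2 * pi : R))%R by rewrite sqrtr_gt0 mulr_gt0// pi_gt0.
  move: (Num.sqrt (2 * pi)) P0 => P P0.
  rewrite sqrtrM ?sqr_ge0// sqrtr_sqr gtr0_norm// sqrtrV ?ltW//.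
  have tT : (t = Num.sqrt t ^+ 2 :> R)%R by rewrite sqr_sqrtr// ltW.
  move: (Num.sqrt t) T0 tT => T T0 ->.
  by field; rewrite !gt_eqF.
by rewrite invf_div mulrCA mulfV ?mulr1// gt_eqF// exprn_gt0.
Qed.

(** Up to normalization, the left integrand is the density of the first pivot
    [x] given the total [t]; [levy_first_line] computes the normalization. *)
Lemma pivot_sampling d (B : measurableType d) (r s A : B -> R) :
  measurable_fun setT r -> measurable_fun setT s -> measurable_fun setT A ->
  (forall b, 0 <= r b) -> (forall b, 0 < s b) -> (forall b, 0 < A b) ->
  exists (Q : probability mR R) (phi : (B * mR) * mR -> mR),
    measurable_fun setT phi /\
    forall b t (h : mR -> \bar R), 0 < t -> measurable_fun setT h ->
      (forall x, 0 <= h x)%E ->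
      (\int[mu]_x ((recip_inverse_gaussian (r b) x *
           levy (A b + r b * s b / `|x|) (t - s b ^+ 2 / x))%:E * h x) =
      (levy (A b + s b) t)%:E * \int[Q]_u h (phi ((b, t), u)))%E.
Proof.
move=> mr ms mA r0 s0 A0.
(* The sampling lemma asks for a probability density at every parameter; the
   total time is replaced by [1] where it is not positive. *)
pose tau (t : mR) : mR := if 0 < t then t else 1.
pose k (p : (B * mR) * mR) := recip_inverse_gaussian (r p.1.1) p.2 *
  levy (A p.1.1 + r p.1.1 * s p.1.1 / `|p.2|) (tau p.1.2 - s p.1.1 ^+ 2 / p.2).
pose l (p : (B * mR) * mR) := levy (A p.1.1 + s p.1.1) (tau p.1.2).
have tau0 t : 0 < tau t by rewrite /tau; case: ifP.
have l0 p : 0 < l p by rewrite levy_gt0// addr_gt0.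
have k0 p : 0 <= k p.
  rewrite mulr_ge0 ?recip_inverse_gaussian_ge0 ?levy_ge0// addr_ge0//; first exact: ltW.
  by rewrite divr_ge0 ?mulr_ge0// ltW.
have m11 : measurable_fun setT (fun p : (B * mR) * mR => p.1.1).
  exact: measurableT_comp measurable_fst measurable_fst.
have m12 : measurable_fun setT (fun p : (B * mR) * mR => p.1.2).
  exact: measurableT_comp measurable_snd measurable_fst.
have mrp := measurableT_comp mr m11.
have msp := measurableT_comp ms m11.
have mAp := measurableT_comp mA m11.
have mtau : measurable_fun setT (fun p : (B * mR) * mR => tau p.1.2).
  by rewrite /tau; repeat measurability_step.
have mabs : measurable_fun setT (fun p : (B * mR) * mR => `|p.2|).
  by apply: measurableT_comp.
have ml : measurable_fun setT l.
  by apply: measurable_fun_levy; repeat measurability_step.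
have mk : measurable_fun setT k.
  apply: measurable_funM; first by apply: measurable_fun_recip_inverse_gaussian.
  by apply: measurable_fun_levy; repeat measurability_step.
have k_int p : (\int[mu]_x (k (p, x))%:E = (l (p, 0))%:E)%E.
  rewrite -(levy_first_line (r0 p.1) (s0 p.1) (A0 p.1) (tau0 p.2)).
  apply: eq_integral => x _; rewrite /k/=.
  have [x0|x0] := ltP 0 x; first by rewrite gtr0_norm.
  by rewrite /recip_inverse_gaussian ltNge x0 !mul0r.
have mkp p : measurable_fun setT (fun x : mR => k (p, x)).
  exact: measurableT_comp mk (measurable_pair1 p).
have [||p|Q [phi [mphi phiE]]] := @quantile_sampling R _ (B * mR)%type (fun p => k p / l p).
- exact: measurable_fun_div.
- by move=> p; rewrite divr_ge0// ltW.
- have lE x : l (p, x) = l (p, 0) by [].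
  under eq_integral do rewrite lE mulrC EFinM.
  rewrite ge0_integralZl_EFin//; last 3 first.
  + by move=> x _; rewrite lee_fin.
  + exact/measurable_EFinP.
  + by rewrite invr_ge0 ltW.
  by rewrite k_int -EFinM mulVf// gt_eqF.
exists Q, phi; split=> // b t h t0 mh h0.
have tauE : tau t = t by rewrite /tau t0.
rewrite phiE// -ge0_integralZl_EFin//; last 3 first.
- by move=> x _; rewrite mule_ge0// lee_fin divr_ge0// ltW.
- apply: emeasurable_funM => //; apply/measurable_EFinP.
  apply: measurable_fun_div => //.
  exact: measurableT_comp ml (measurable_pair1 (b, t)).
- by rewrite levy_ge0// addr_ge0// ltW.
apply: eq_integral => x _; rewrite muleA -EFinM; congr (_%:E * _)%E.
rewrite /k /l/= tauE; field.
by rewrite gt_eqF// levy_gt0// addr_gt0.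
Qed.

Definition sampler_hyp n d (B : measurableType d) (W : B -> 'M[R]_n)
    (e : B -> 'rV[R]_n) : Prop :=
  [/\ measurable_mx W, measurable_mx e, forall b, (W b)^T = W b,
    forall b i j, i != j -> 0 <= W b i j & forall b j, 0 < e b 0 j].

Lemma pivot_sampler_hyp n d (B : measurableType d) (W : B -> 'M[R]_(1 + n))
    (e : B -> 'rV[R]_(1 + n)) : sampler_hyp W e ->
  sampler_hyp (fun p : B * mR => pivot_weight (W p.1) p.2)
              (fun p : B * mR => pivot_vector (W p.1) (e p.1) p.2).
Proof.
move=> [mW me sW W0 e0].
have mabs : measurable_fun setT (fun p : B * mR => `|p.2|^-1).
  apply: measurable_funV; exact: measurableT_comp.
have mW1 i j : measurable_fun setT (fun p : B * mR => W p.1 i j).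
  exact: measurableT_comp (mW i j) measurable_fst.
have me1 i j : measurable_fun setT (fun p : B * mR => e p.1 i j).
  exact: measurableT_comp (me i j) measurable_fst.
split.
- move=> i j; rewrite /pivot_weight; under eq_fun do rewrite !mxE big_ord1 !mxE.
  apply: measurable_funD => //; apply: measurable_funM => //.
  exact: measurable_funM.
- move=> i j; rewrite /pivot_vector; under eq_fun do rewrite !mxE.
  apply: measurable_funD => //; apply: measurable_funM => //.
  exact: measurable_funM.
- by move=> p; exact: pivot_weight_sym.
- move=> p i j ij; rewrite /pivot_weight !mxE big_ord1 !mxE addr_ge0//.
    by apply: W0; rewrite (inj_eq (@rshift_inj _ _)).
  by rewrite mulr_ge0// mulr_ge0// W0// eq_lrshift.
- move=> p j; rewrite /pivot_vector !mxE ltr_wpDr// mulr_ge0//.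
    by rewrite mulr_ge0// ltW.
  by rewrite W0// eq_lrshift.
Qed.

(** The noise consists of one for the first pivot and of one for the rest, the
    total time left for the latter being [t - s ^+ 2 / x]. *)
Lemma samplerS n :
  (forall d (B : measurableType d) (W : B -> 'M[R]_n.+1) (e : B -> 'rV[R]_n.+1),
    sampler_hyp W e -> sampler_spec W e) ->
  forall d (B : measurableType d) (W : B -> 'M[R]_(1 + n.+1))
    (e : B -> 'rV[R]_(1 + n.+1)), sampler_hyp W e -> sampler_spec W e.
Proof.
move=> IH d B W e WeH; have [mW me sW W0 e0] := WeH.
have [d' [Xi [Q' [Phi' [mPhi' Phi'E]]]]] := IH _ _ _ _ (pivot_sampler_hyp WeH).
pose r b := \sum_j ursubmx (W b) 0 j.
pose s b := e b 0 0.
pose A b := \sum_j rsubmx (e b) 0 j.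
have r0 b : 0 <= r b by apply: sumr_ge0 => j _; rewrite !mxE W0// eq_lrshift.
have s0 b : 0 < s b by exact: e0.
have A0 b : 0 < A b.
  rewrite /A big_ord_recl ltr_pwDl//; first by rewrite mxE.
  by apply: sumr_ge0 => j _; rewrite mxE ltW.
have mr : measurable_fun setT r.
  by apply: measurable_sum => j; under eq_fun do rewrite !mxE; exact: mW.
have ms : measurable_fun setT s by exact: me.
have mA : measurable_fun setT A.
  by apply: measurable_sum => j; under eq_fun do rewrite !mxE; exact: me.
have [Q [phi [mphi phiE]]] := pivot_sampling mr ms mA r0 s0 A0.
pose a b (x : mR) : mR := 2^-1 * x + 2^-1 * W b 0 0.
pose Phi (p : (B * mR) * (mR * Xi)) : n.+2.-tuple mR :=
  let x := phi (p.1, p.2.1) in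
  [tuple of a p.1.1 x :: Phi' (((p.1.1, x), p.1.2 - s p.1.1 ^+ 2 / x), p.2.2)].
have ma d2 (T2 : measurableType d2) (f : T2 -> B) (g : T2 -> mR) :
    measurable_fun setT f -> measurable_fun setT g ->
    measurable_fun setT (fun y => a (f y) (g y)).
  move=> mf mg; have mWf := measurableT_comp (mW 0 0) mf.
  by rewrite /a; repeat measurability_step.
have mPhix d2 (T2 : measurableType d2) (f : T2 -> B) (t x : T2 -> mR) (xi : T2 -> Xi) :
    measurable_fun setT f -> measurable_fun setT t -> measurable_fun setT x ->
    measurable_fun setT xi -> measurable_fun setT (fun y => [tuple of a (f y) (x y) ::
      Phi' (((f y, x y), t y - s (f y) ^+ 2 / x y), xi y)]).
  move=> mf mt mx mxi; apply: measurable_cons; first exact: ma.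
  apply: (measurableT_comp mPhi'); apply: measurable_fun_pair => //.
  have msf := measurableT_comp ms mf.
  apply: measurable_fun_pair; first exact: measurable_fun_pair.
  by repeat measurability_step.
exists _, (mR * Xi)%type, (Q \x Q')%E, Phi; split.
  apply: mPhix.
  - exact: measurableT_comp measurable_fst measurable_fst.
  - exact: measurableT_comp measurable_snd measurable_fst.
  - apply: (measurableT_comp mphi); apply: measurable_fun_pair => //.
    exact: measurableT_comp measurable_fst measurable_snd.
  - exact: measurableT_comp measurable_snd measurable_snd.
move=> b Psi mPsi Psi0.
pose F (beta : n.+2.-tuple mR) := ((potential_mx_density (pot_mx (W b) beta))%:E *
  Psi (quad (invmx (pot_mx (W b) beta)) (e b), beta))%E.
have mF : measurable_fun setT F by exact: measurable_sampler_integrand.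
have F0 beta : (0 <= F beta)%E.
  by rewrite mule_ge0// lee_fin potential_mx_density_ge0.
have mFc : measurable_fun setT
    (fun p : mR * n.+1.-tuple mR => F [tuple of p.1 :: p.2]).
  by apply: (measurableT_comp mF); exact: measurable_cons.
pose body (t x : mR) (xi : Xi) : n.+2.-tuple mR :=
  [tuple of a b x :: Phi' (((b, x), t - s b ^+ 2 / x), xi)].
have mbody : measurable_fun setT (fun p : (mR * mR) * Xi => body p.1.2 p.1.1 p.2).
  apply: mPhix => //.
  - exact: measurableT_comp measurable_snd measurable_fst.
  - exact: measurableT_comp measurable_fst measurable_fst.
pose H (t x : mR) := (\int[Q']_xi Psi (t, body t x xi))%E.
pose K (p : mR * mR) := recip_inverse_gaussian (r b) p.1 *
   levy (A b + r b * s b / `|p.1|) (p.2 - s b ^+ 2 / p.1).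
rewrite [LHS](ge0_integral_lebesgue_tupleS mF F0).
rewrite [LHS](@ge0_integral_affine R 2^-1 (2^-1 * W b 0 0)
  (fun x => \int[lebesgue_tuple R n.+1]_beta F [tuple of x :: beta])%E)//; last 2 first.
- exact: (measurable_fun_fubini_tonelli_F _ mFc).
- by move=> x; apply: integral_ge0.
have mH : measurable_fun setT (fun p : mR * mR => H p.2 p.1).
  have mPb : measurable_fun setT
      (fun p : (mR * mR) * Xi => Psi (p.1.2, body p.1.2 p.1.1 p.2)).
    apply: (measurableT_comp mPsi); apply: measurable_fun_pair => //.
    exact: measurableT_comp measurable_snd measurable_fst.
  by apply: (measurable_fun_fubini_tonelli_F _ mPb) => p; exact: Psi0.
have mHx x : measurable_fun setT (fun t => H t x).
  exact: measurableT_comp mH (measurable_pair1 x).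
have mHt t : measurable_fun setT (fun x => H t x).
  exact: measurableT_comp mH (measurable_pair2 t).
have H0 t x : (0 <= H t x)%E by exact: integral_ge0.
have Ars0 x : 0 <= A b + r b * s b / `|x|.
  by rewrite addr_ge0 ?divr_ge0 ?mulr_ge0// ltW.
have K0 p : 0 <= K p.
  by rewrite mulr_ge0 ?recip_inverse_gaussian_ge0 ?levy_ge0.
have mK : measurable_fun setT K.
  have mabs : measurable_fun setT (fun p : mR * mR => `|p.1|).
    by apply: measurableT_comp.
  apply: measurable_funM.
    by apply: measurable_fun_recip_inverse_gaussian => //; exact: measurable_cst.
  by apply: measurable_fun_levy; repeat measurability_step.
(* For a fixed pivot [x], the induction hypothesis applies to the remaining
   vertices; a translation then makes the total time [t] the variable. *)
have inner x : 0 < x -> (2^-1%:E * \int[lebesgue_tuple R n.+1]_beta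
    F [tuple of a b x :: beta] = \int[mu]_t ((K (x, t))%:E * H t x))%E.
  move=> x0; pose Psi' (p : mR * n.+1.-tuple mR) :=
    Psi (s b ^+ 2 / x + p.1, [tuple of a b x :: p.2]).
  have mPsi' : measurable_fun setT Psi'.
    apply: (measurableT_comp mPsi); apply: measurable_fun_pair.
      by repeat measurability_step.
    by apply: measurable_cons => //; exact: measurable_cst.
  rewrite -ge0_integralZl_EFin//; last first.
    by apply: (measurableT_comp mF); exact: measurable_cons.
  transitivity ((recip_inverse_gaussian (r b) x)%:E * \int[lebesgue_tuple R n.+1]_beta
    ((potential_mx_density (pot_mx (pivot_weight (W b) x) beta))%:E *
     Psi' (quad (invmx (pot_mx (pivot_weight (W b) x) beta))
                (pivot_vector (W b) (e b) x), beta)))%E.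
    rewrite -ge0_integralZl_EFin//; last 3 first.
    - move=> beta _; apply: mule_ge0; last exact: Psi0.
      by rewrite lee_fin potential_mx_density_ge0.
    - apply: measurable_sampler_integrand => //.
      exact: pivot_weight_sym.
    - exact: recip_inverse_gaussian_ge0.
    apply: eq_integral => beta _; rewrite /F potential_density_cons//.
    have [pS|pS] := pselect (posdef_mx (pot_mx (pivot_weight (W b) x) beta)).
      rewrite green_weight_cons// !muleA -!EFinM; congr (_%:E * _)%E.
      by rewrite !mulrA mulVf// mul1r.
    by rewrite /potential_mx_density (asboolF pS) mulr0 !mul0e !mule0.
  have sumE : \sum_j pivot_vector (W b) (e b) x 0 j = A b + r b * s b / `|x|.
    rewrite /A /r mulr_suml mulr_suml -big_split/=; apply: eq_bigr => j _.
    by rewrite !mxE /s; ring.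
  have mJ : measurable_fun setT
      (fun t : mR => \int[Q']_xi Psi' (t, Phi' (((b, x), t), xi)))%E.
    have mJ' : measurable_fun setT
        (fun p : mR * Xi => Psi' (p.1, Phi' (((b, x), p.1), p.2))).
      apply: (measurableT_comp mPsi'); apply: measurable_fun_pair => //.
      apply: (measurableT_comp mPhi'); apply: measurable_fun_pair => //.
      by apply: measurable_fun_pair => //; exact: measurable_cst.
    by apply: (measurable_fun_fubini_tonelli_F _ mJ') => p; exact: Psi0.
  have J0 t : (0 <= \int[Q']_xi Psi' (t, Phi' (((b, x), t), xi)))%E.
    by apply: integral_ge0 => xi _; exact: Psi0.
  have mlev : measurable_fun setT (fun t : mR =>
      (levy (A b + r b * s b / `|x|) t)%:E * \int[Q']_xi Psi' (t, Phi' (((b, x), t), xi)))%E.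
    apply: emeasurable_funM => //; apply/measurable_EFinP.
    by apply: measurable_fun_levy => //; exact: measurable_cst.
  have lev0 t : (0 <= (levy (A b + r b * s b / `|x|) t)%:E *
      \int[Q']_xi Psi' (t, Phi' (((b, x), t), xi)))%E.
    by rewrite mule_ge0// lee_fin levy_ge0.
  have Psi'0 p : (0 <= Psi' p)%E by exact: Psi0.
  rewrite (Phi'E (b, x) Psi' mPsi' Psi'0)/= sumE.
  rewrite [X in (_ * X)%E](@ge0_integral_affine R 1 (- (s b ^+ 2 / x)) _ ltr01 mlev lev0)//.
  rewrite -ge0_integralZl_EFin//; last 3 first.
  - by move=> t _; rewrite mul1r mul1e; exact: lev0.
  - under eq_fun do rewrite mul1r mul1e.
    by apply: (measurableT_comp mlev); repeat measurability_step.
  - exact: recip_inverse_gaussian_ge0.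
  apply: eq_integral => t _; rewrite mul1r mul1e muleA -EFinM.
  rewrite /K/= /H /Psi'/=; congr (_%:E * _)%E.
  apply: eq_integral => xi _; congr (Psi (_, _)).
  by rewrite addrC subrK.
transitivity (\int[mu]_x \int[mu]_t ((K (x, t))%:E * H t x))%E.
  apply: eq_integral => x _.
  have [x0|x0] := ltP 0 x; first exact: inner.
  rewrite [RHS]integral0_eq; last first.
    by move=> t _; rewrite /K/= /recip_inverse_gaussian ltNge x0 mul0r mul0e.
  rewrite integral0_eq ?mule0// => beta _.
  by rewrite /F potential_density_cons// /recip_inverse_gaussian ltNge x0 mulr0 mul0r mul0e.
rewrite (fubini_tonelli (fun p : mR * mR => (K p)%:E * H p.2 p.1)%E)/=; last 2 first.
- by apply: emeasurable_funM => //; exact/measurable_EFinP.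
- by move=> p; rewrite mule_ge0// lee_fin.
apply: eq_integral => t _.
have -> : \sum_j e b 0 j = A b + s b.
  rewrite big_ord_recl addrC; congr (_ + _); apply: eq_bigr => j _.
  by rewrite mxE; congr (e b 0 _); apply/val_inj.
have [t0|t0] := ltP 0 t; last first.
  rewrite /levy ltNge t0 mul0e integral0_eq// => x _; rewrite /K/=.
  have [x0|x0] := ltP 0 x; last by rewrite /recip_inverse_gaussian ltNge x0 mul0r mul0e.
  rewrite /levy ltNge (le_trans _ t0) ?mulr0 ?mul0e// gerBl.
  by rewrite divr_ge0 ?sqr_ge0// ltW.
rewrite -[LHS]/(\int[mu]_x ((recip_inverse_gaussian (r b) x *
  levy (A b + r b * s b / `|x|) (t - s b ^+ 2 / x))%:E * H t x))%E.
rewrite (phiE b t (H t) t0 (mHt t) (H0 t)); congr (_ * _)%E.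
have mPt : measurable_fun setT (fun p : mR * Xi => Psi (t, Phi ((b, t), p))).
  apply: (measurableT_comp mPsi); apply: measurable_fun_pair => //.
  apply: mPhix => //=; last exact: measurable_snd.
  apply: (measurableT_comp mphi); apply: measurable_fun_pair.
    exact: measurable_cst.
  exact: measurable_fst.
by rewrite [RHS](fubini_tonelli1 _ mPt).
Qed.

Theorem sampler n d (B : measurableType d) (W : B -> 'M[R]_n.+1)
    (e : B -> 'rV[R]_n.+1) : sampler_hyp W e -> sampler_spec W e.
Proof.
elim: n d B W e => [|n IH] d B W e WeH; last exact: (samplerS IH).
by have [mW me _ _ e0] := WeH; exact: sampler1.
Qed.

End sampler.

(** * Matrices indexed by a finite type *)

Section enumeration.
Variables (R : realType) (I : finType) (m : nat) (c : 'I_m -> I) (p : I -> 'I_m).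
Hypotheses (cK : cancel c p) (pK : cancel p c).
Implicit Type A : I -> I -> R.

(** An [I]-indexed matrix read along any enumeration of [I]. Its total, its
    positivity, its determinant and its inverse do not depend on [c]. *)
Definition mx_along A : 'M[R]_m := \matrix_(i, j) A (c i) (c j).

Let sum_along (F : I -> R) : \sum_i F i = \sum_j F (c j).
Proof. by rewrite (reindex c)//; exists p => i _; [exact: cK|exact: pK]. Qed.

Lemma mx_total_along A : \sum_i \sum_j A i j = mx_total (mx_along A).
Proof.
rewrite sum_along; apply: eq_bigr => i _; rewrite sum_along.
by apply: eq_bigr => j _; rewrite mxE.
Qed.

Lemma posdef_along A : posdef A <-> posdef_mx (mx_along A).
Proof.
have E (x : 'rV[R]_m) (y : I -> R) : (forall i, y (c i) = x 0 i) ->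
    \sum_i \sum_j y i * A i j * y j = quad (mx_along A) x.
  move=> yx; rewrite /quad mxE sum_along exchange_big/=.
  rewrite sum_along; apply: eq_bigr => j _; rewrite yx !mxE mulr_suml.
  by apply: eq_bigr => i _; rewrite yx mxE.
split=> pA x.
  move=> x0; rewrite -(E x (fun i => x 0 (p i))); last by move=> i; rewrite cK.
  apply: pA; have [i xi] : exists i, x 0 i != 0.
    apply/existsP; apply: contraNT x0 => /existsPn x0.
    by apply/eqP/rowP => i; rewrite mxE; apply/eqP/negPn/x0.
  by exists (c i); rewrite cK.
move=> [i xi]; rewrite (E (\row_j x (c j))) => [|j]; last by rewrite mxE.
apply: pA; apply: contraNneq xi => /rowP/(_ (p i)).
by rewrite !mxE pK => ->.
Qed.

Lemma det_along A : \det (mx_of A) = \det (mx_along A).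
Proof.
have mE : m = #|I|.
  by rewrite -(card_ord m); apply: bij_eq_card; exists p.
rewrite /mx_along; clear sum_along; subst m.
have inj : injective (fun i => enum_rank (c i)).
  by move=> i j /enum_rank_inj/(can_inj cK).
have -> : \matrix_(i, j) A (c i) (c j) =
    row_perm (perm inj) (col_perm (perm inj) (mx_of A)).
  by apply/matrixP => i j; rewrite !mxE !permE !enum_rankK.
rewrite row_permE col_permE !det_mulmx !det_perm mulrCA odd_permV.
by rewrite -expr2 sqrr_sign mulr1.
Qed.

Lemma invmx_along A i j : mx_along A \in unitmx ->
  invmx (mx_of A) (enum_rank i) (enum_rank j) = invmx (mx_along A) (p i) (p j).
Proof.
move=> uA; pose X := \matrix_(k, l) invmx (mx_of A) (enum_rank (c k)) (enum_rank (c l)).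
suff XA : X *m mx_along A = 1%:M.
  have <- : X = invmx (mx_along A) by rewrite -(mulmx1 X) -(mulmxV uA) mulmxA XA mul1mx.
  by rewrite mxE !pK.
have uA' : mx_of A \in unitmx by rewrite unitmxE det_along.
apply/matrixP => k l; have /matrixP/(_ (enum_rank (c k)) (enum_rank (c l))) := mulVmx uA'.
rewrite !mxE (inj_eq enum_rank_inj) (inj_eq (can_inj cK)) => <-.
rewrite (reindex (fun q => enum_rank (c q))).
  by apply: eq_bigr => q _; rewrite !mxE !enum_rankK.
exists (fun q => p (enum_val q)) => q _; first by rewrite enum_rankK cK.
by rewrite pK enum_valK.
Qed.

End enumeration.

Section two_blocks.
Variables (R : realType) (I : finType) (a n : nat).
Variables (pos : I -> 'I_a + 'I_n) (ver : 'I_a + 'I_n -> I).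
Hypotheses (verK : cancel ver pos) (posK : cancel pos ver).
Local Notation mR := (measurableTypeR R).

(** The indices in the last component of the sum type come first in the block
    matrices below, since that block is the one to be eliminated. *)
Definition block_ver (i : 'I_(n + a)) : I :=
  match fintype.split i with inl j => ver (inr j) | inr j => ver (inl j) end.

Definition block_pos (i : I) : 'I_(n + a) :=
  match pos i with inl j => rshift n j | inr j => lshift a j end.

Lemma block_ver_lshift j : block_ver (lshift a j) = ver (inr j).
Proof. by rewrite /block_ver -/(unsplit (inl j)) unsplitK. Qed.

Lemma block_ver_rshift j : block_ver (rshift n j) = ver (inl j).
Proof. by rewrite /block_ver -/(unsplit (inr j)) unsplitK. Qed.

Lemma block_verK : cancel block_ver block_pos.
Proof.
move=> i; case: (split_ordP i) => j ->;
  by rewrite ?block_ver_lshift ?block_ver_rshift /block_pos verK.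
Qed.

Lemma block_posK : cancel block_pos block_ver.
Proof.
move=> i; rewrite /block_pos; case E : (pos i) => [j|j];
  by rewrite ?block_ver_lshift ?block_ver_rshift -E posK.
Qed.

Definition merge (s : a.-tuple mR) (t : n.-tuple mR) : {ffun I -> R} :=
  [ffun i => match pos i with inl j => tnth s j | inr j => tnth t j end].

Variable W : I -> I -> R.
Hypotheses (Wsym : forall i j, W i j = W j i) (W0 : forall i, W i i = 0).

Definition inner_weight : 'M[R]_n := \matrix_(i, j) W (ver (inr i)) (ver (inr j)).
Definition outer_weight : 'M[R]_a := \matrix_(i, j) W (ver (inl i)) (ver (inl j)).
Definition cross_weight : 'M[R]_(n, a) := \matrix_(i, j) W (ver (inr i)) (ver (inl j)).

Definition block_potential s t : 'M[R]_(n + a) :=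
  block_mx (pot_mx inner_weight t) (- cross_weight)
    (- cross_weight)^T (pot_mx outer_weight s).

Lemma Hmat_merge s t : mx_along block_ver (Hmat W (merge s t)) = block_potential s t.
Proof.
have inj x y : (ver x == ver y) = (x == y) by rewrite (can_eq verK).
rewrite -[LHS]submxK; congr block_mx; apply/matrixP => i j;
  rewrite !mxE ?block_ver_lshift ?block_ver_rshift /Hmat ffunE verK inj /=.
- rewrite (inj_eq (@inr_inj _ _)); case: eqP => [->|_]; last by rewrite sub0r.
  by rewrite W0 subr0.
- by [].
- by rewrite Wsym.
- rewrite (inj_eq (@inl_inj _ _)); case: eqP => [->|_]; last by rewrite sub0r.
  by rewrite W0 subr0.
Qed.

Lemma potential_density_merge s t :
  potential_density W (merge s t) = potential_mx_density (block_potential s t).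
Proof.
rewrite -Hmat_merge /potential_density /potential_mx_density.
rewrite (asbool_equiv_eq (posdef_along block_verK block_posK _)).
rewrite (det_along block_verK block_posK) (mx_total_along block_verK block_posK).
suff -> : #|I| = (n + a)%N by [].
rewrite -(card_ord (n + a)); apply: bij_eq_card; exists block_ver.
  exact: block_posK.
exact: block_verK.
Qed.

Lemma green_merge s t i j : posdef_mx (block_potential s t) ->
  green W (merge s t) (i, j) =
  invmx (block_potential s t) (block_pos i) (block_pos j).
Proof.
move=> pM; rewrite ffunE/= (invmx_along block_verK block_posK) Hmat_merge//.
exact: posdef_mx_unit.
Qed.

End two_blocks.

(** * Potentials coupled to the rest through a rank-one block *)

Section coupling.
Variables (R : realType) (a : nat) (w : 'rV[R]_a) (P : 'M[R]_a).
Hypothesis Psym : P^T = P.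

(** The block [D] interacts with the rest through the single vector [w], with
    intensities [e]. Hence the Schur complement, and all that the rest can see
    of [D], depends on [D] and [e] only through the number
    [quad (invmx D) e]. *)
Definition coupled n (D : 'M[R]_n) (e : 'rV[R]_n) : 'M[R]_(n + a) :=
  block_mx D (- (e^T *m w)) (- (e^T *m w))^T P.

Definition remainder (tau : R) : 'M[R]_a := P - tau *: (w^T *m w).

Section one_block.
Variables (n : nat) (D : 'M[R]_n) (e : 'rV[R]_n).
Hypotheses (Dsym : D^T = D) (pD : posdef_mx D).
Let uD : D \in unitmx := posdef_mx_unit pD.
Let tau := quad (invmx D) e.

Let scale11 (x : 'M[R]_1) k l (u : 'M[R]_(k, 1)) (v : 'M[R]_(1, l)) :
  u *m x *m v = x 0 0 *: (u *m v).
Proof. by rewrite {1}[x]mx11_scalar mul_mx_scalar scalemxAl. Qed.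

Lemma coupled_cross : (- (e^T *m w))^T *m invmx D *m (- (e^T *m w)) =
  tau *: (w^T *m w).
Proof.
have -> : (- (e^T *m w))^T = - (w^T *m e) by rewrite linearN/= trmx_mul trmxK.
rewrite !mulNmx mulmxN opprK -/(quad _ _) -scale11.
by rewrite !mulmxA.
Qed.

Lemma coupled_schur : schur D (- (e^T *m w)) P = remainder tau.
Proof. by rewrite /schur coupled_cross. Qed.

Lemma coupled_posdef : posdef_mx (coupled D e) <-> posdef_mx (remainder tau).
Proof.
rewrite -coupled_schur; split; first by case/(schur_posdef _ _ Dsym uD).
by move=> pS; apply/(schur_posdef _ _ Dsym uD).
Qed.

Lemma coupled_density : potential_mx_density (coupled D e) =
  potential_mx_density D *
  expR ((\sum_i e 0 i) * (\sum_j w 0 j) - 1 / 2 * (tau * (\sum_j w 0 j) ^+ 2)) *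
  potential_mx_density (remainder tau).
Proof.
rewrite potential_mx_density_block// coupled_schur; congr (_ * expR _ * _).
rewrite coupled_cross; congr (_ - _ * _).
  rewrite -sumrN mulr_suml; apply: eq_bigr => i _.
  rewrite -sumrN mulr_sumr; apply: eq_bigr => j _.
  by rewrite !mxE big_ord1 !mxE opprK.
rewrite expr2 mulr_suml mulr_sumr; apply: eq_bigr => i _.
rewrite !mulr_sumr; apply: eq_bigr => j _.
by rewrite !mxE big_ord1 !mxE.
Qed.

Section inverse.
Hypothesis pS : posdef_mx (remainder tau).
Let Si := invmx (remainder tau).
Let psi := invmx D *m e^T.
Let kappa := quad Si w.

Let Si_sym : Si^T = Si.
Proof.
by rewrite trmx_inv /remainder linearB/= linearZ/= trmx_mul trmxK Psym.
Qed.

Let psiw : invmx D *m - (e^T *m w) = - (psi *m w).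
Proof. by rewrite mulmxN mulmxA. Qed.

Let inv_block : invmx (coupled D e) =
  block_mx (invmx D + kappa *: (psi *m psi^T)) (psi *m (w *m Si))
           ((w *m Si)^T *m psi^T) Si.
Proof.
rewrite schur_inv// coupled_schur; last exact: posdef_mx_unit.
rewrite -/Si psiw !mulNmx opprK; congr block_mx.
- congr (_ + _); rewrite linearN/= mulmxN opprK (trmx_mul psi) mulmxA.
  by rewrite -(mulmxA psi w) -(mulmxA psi) [LHS]scale11.
- by rewrite mulmxA.
- by rewrite linearN/= mulmxN opprK (trmx_mul psi) (trmx_mul w) Si_sym mulmxA.
Qed.

Lemma coupled_inv_ul i j : invmx (coupled D e) (lshift a i) (lshift a j) =
  invmx D i j + kappa * (psi i 0 * psi j 0).
Proof.
rewrite inv_block block_mxEul mxE; congr (_ + _).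
by rewrite mxE; congr (_ * _); rewrite mxE big_ord1; congr (_ * _); rewrite mxE.
Qed.

Lemma coupled_inv_ur i j : invmx (coupled D e) (lshift a i) (rshift n j) =
  psi i 0 * (w *m Si) 0 j.
Proof. by rewrite inv_block block_mxEur mxE big_ord1. Qed.

Lemma coupled_inv_dl i j : invmx (coupled D e) (rshift n j) (lshift a i) =
  psi i 0 * (w *m Si) 0 j.
Proof.
by rewrite inv_block block_mxEdl mxE big_ord1 [psi^T _ _]mxE [_^T _ _]mxE mulrC.
Qed.

Lemma coupled_inv_dr i j : invmx (coupled D e) (rshift n i) (rshift n j) = Si i j.
Proof. by rewrite inv_block block_mxEdr. Qed.

End inverse.

End one_block.

(** Two blocks which the rest cannot tell apart may be exchanged: the factor due
    to the rest is the same in both densities. *)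
Lemma coupled_density_exchange n1 n2 (D1 : 'M[R]_n1) (D2 : 'M[R]_n2) e1 e2 :
  D1^T = D1 -> D2^T = D2 -> posdef_mx D1 -> posdef_mx D2 ->
  quad (invmx D1) e1 = quad (invmx D2) e2 ->
  \sum_i e1 0 i = \sum_i e2 0 i ->
  potential_mx_density (coupled D1 e1) * potential_mx_density D2 =
  potential_mx_density D1 * potential_mx_density (coupled D2 e2).
Proof.
move=> s1 s2 p1 p2 qE eE; rewrite !coupled_density// qE eE.
by ring.
Qed.

End coupling.

(** * Green matrices before and after fusing [U] *)

Lemma green_coupled (R : realType) (I : finType) (a n : nat)
    (pos : I -> 'I_a + 'I_n) (ver : 'I_a + 'I_n -> I)
    (verK : cancel ver pos) (posK : cancel pos ver) (W : I -> I -> R)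
    (Wsym : forall i j, W i j = W j i) (W0 : forall i, W i i = 0)
    s t (w : 'rV[R]_a) P (D : 'M[R]_n) e :
  P^T = P -> D^T = D -> posdef_mx D ->
  block_potential ver W s t = coupled w P D e ->
  posdef_mx (remainder w P (quad (invmx D) e)) ->
  let Si := invmx (remainder w P (quad (invmx D) e)) in
  let psi := invmx D *m e^T in
  forall i j, green W (merge pos s t) (i, j) =
    match pos i, pos j with
    | inl k, inl l => Si k l
    | inl k, inr l | inr l, inl k => psi l 0 * (w *m Si) 0 k
    | inr k, inr l => invmx D k l + quad Si w * (psi k 0 * psi l 0)
    end.
Proof.
move=> Psym Dsym pD ME pS Si psi i j.
rewrite (green_merge verK posK) ?ME//; last exact/coupled_posdef.
rewrite /block_pos; case: (pos i) (pos j) => [k|k] [l|l].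
- exact: coupled_inv_dr.
- exact: coupled_inv_dl.
- exact: coupled_inv_ur.
- exact: coupled_inv_ul.
Qed.

Section fusion.
Variables (R : realType) (V : finType) (W : V -> V -> R) (U : {set V}).
Hypotheses (hW : weighted_graph W) (hind : indistinguishable W U).
Variables (i0 : V) (i0U : i0 \in U).
Local Notation mR := (measurableTypeR R).
Local Notation T := {k : V | k \notin U}.
Local Notation a := #|{: T}|.
Local Notation n := #|U|.
Local Notation W' := (reduced_weight W U).

Definition vertex_pos (i : V) : 'I_a + 'I_n :=
  if insub i is Some k then inl (enum_rank (k : T)) else inr (enum_rank_in i0U i).

Definition vertex_of (s : 'I_a + 'I_n) : V :=
  match s with inl j => val (enum_val j : T) | inr j => enum_val j end.

Definition reduced_pos (i : reduced_vertex U) : 'I_a + 'I_1 :=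
  if i is Some k then inl (enum_rank (k : T)) else inr ord0.

Definition reduced_of (s : 'I_a + 'I_1) : reduced_vertex U :=
  match s with inl j => Some (enum_val j : T) | inr _ => None end.

Lemma vertex_posK : cancel vertex_pos vertex_of.
Proof.
move=> i; rewrite /vertex_pos; case: insubP => [k iU ki|/negPn iU] /=.
  by rewrite enum_rankK.
by rewrite enum_rankK_in.
Qed.

Lemma vertex_ofK : cancel vertex_of vertex_pos.
Proof.
case=> j; rewrite /vertex_pos /=; first by rewrite valK enum_valK.
by rewrite insubN ?negbK ?enum_valP// enum_valK_in.
Qed.

Lemma reduced_posK : cancel reduced_pos reduced_of.
Proof. by case=> //= k; rewrite enum_rankK. Qed.

Lemma reduced_ofK : cancel reduced_of reduced_pos.
Proof. by case=> j /=; rewrite /reduced_pos ?enum_valK// (ord1 j). Qed.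

Let Wsym := weight_sym hW.
Let W0 := weight_diag hW.

Lemma reduced_weight_sym k l : W' k l = W' l k.
Proof. by case: k l => [k|] [l|] //=. Qed.

Lemma reduced_weight_diag k : W' k k = 0.
Proof. by case: k => [k|] //=. Qed.

Let w : 'rV[R]_a := \row_j W (val (enum_val j : T)) i0.
Let P s : 'M[R]_a := pot_mx (outer_weight vertex_of W) s.
Let D t : 'M[R]_n := pot_mx (inner_weight vertex_of W) t.

Let outer_sym : (outer_weight vertex_of W)^T = outer_weight vertex_of W.
Proof. by apply/matrixP => i j; rewrite !mxE. Qed.

Let inner_sym : (inner_weight vertex_of W)^T = inner_weight vertex_of W.
Proof. by apply/matrixP => i j; rewrite !mxE. Qed.

Let Psym s : (P s)^T = P s. Proof. exact: pot_mx_sym. Qed.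
Let Dsym t : (D t)^T = D t. Proof. exact: pot_mx_sym. Qed.

Let block_full s t :
  block_potential vertex_of W s t = coupled w (P s) (D t) (const_mx 1).
Proof.
rewrite /block_potential /coupled.
have -> // : cross_weight vertex_of W = (const_mx 1 : 'rV[R]_n)^T *m w.
apply/matrixP => i j; rewrite !mxE big_ord1 !mxE mul1r/=.
by rewrite Wsym; apply: hind; rewrite ?enum_valP// (valP (enum_val j : T)).
Qed.

Let block_reduced s b : block_potential reduced_of W' s [tuple b : mR] =
  coupled w (P s) ((2 * b)%:M : 'M[R]_1) (const_mx n%:R).
Proof.
rewrite /block_potential /coupled.
have -> : cross_weight reduced_of W' = (const_mx n%:R : 'rV[R]_1)^T *m w.
  apply/matrixP => i j; rewrite !mxE big_ord1 !mxE/= mulr_natl -sumr_const.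
  apply: eq_bigr => k kU.
  by apply: hind; rewrite ?(valP (enum_val j : T)).
congr block_mx.
by apply/matrixP => i j; rewrite !mxE !ord1/= subr0 mulr1n.
Qed.

Let n0 : 0 < n%:R :> R.
Proof. by rewrite ltr0n card_gt0; apply/set0Pn; exists i0. Qed.

Definition green_weight (t : n.-tuple mR) : R := quad (invmx (D t)) (const_mx 1).

Lemma green_weight_gt0 t : posdef_mx (D t) -> 0 < green_weight t.
Proof.
move=> pD; have uD := posdef_mx_unit pD; rewrite /green_weight.
have -> : quad (invmx (D t)) (const_mx 1) = quad (D t) (const_mx 1 *m invmx (D t)).
  by rewrite /quad trmx_mul trmx_inv Dsym mulmxKV// mulmxA.
apply: pD; apply/negP => /eqP e0.
have : (const_mx 1 : 'rV[R]_n) != 0.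
  apply/eqP => /rowP/(_ (enum_rank_in i0U i0)); rewrite !mxE.
  by apply/eqP; rewrite oner_eq0.
by rewrite -[const_mx 1](mulmxKV uD) e0 mul0mx eqxx.
Qed.

(** The potential of the fused vertex for which the outside cannot tell it from
    [U]: both then have the same quadratic form, [reduced_quad] below. *)
Definition fused_potential (t : n.-tuple mR) : mR := 2^-1 * (n%:R ^+ 2 / green_weight t).

Let fusedE t : 2 * fused_potential t = n%:R ^+ 2 / green_weight t.
Proof. by rewrite mulrA divff ?mul1r. Qed.

Let reduced_quad t : posdef_mx (D t) ->
  quad (invmx ((2 * fused_potential t)%:M : 'M[R]_1)) (const_mx n%:R) = green_weight t.
Proof.
move=> pD; have t0 := green_weight_gt0 pD.
rewrite fusedE invmx_scalar /quad mul_mx_scalar -scalemxAl mxE mxE big_ord1 !mxE.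
by field; rewrite !gt_eqF.
Qed.

Let reduced_posdef t : posdef_mx (D t) ->
  posdef_mx ((2 * fused_potential t)%:M : 'M[R]_1).
Proof.
move=> /green_weight_gt0 t0; apply/posdef_mx_scalar.
by rewrite fusedE divr_gt0// exprn_gt0.
Qed.

Lemma density_exchange s t : posdef_mx (D t) ->
  potential_density W (merge vertex_pos s t) *
    potential_mx_density ((2 * fused_potential t)%:M : 'M[R]_1) =
  potential_mx_density (D t) *
    potential_density W' (merge reduced_pos s [tuple fused_potential t]).
Proof.
move=> pD; rewrite (potential_density_merge vertex_ofK vertex_posK)//.
rewrite (potential_density_merge reduced_ofK reduced_posK) ?block_full ?block_reduced.
- apply: coupled_density_exchange => //; rewrite ?tr_scalar_mx//.
  + exact: reduced_posdef.
  + by rewrite reduced_quad.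
  + rewrite big_ord1 mxE (eq_bigr (fun=> 1)) => [|i _]; last by rewrite mxE.
    by rewrite sumr_const card_ord.
- exact: reduced_weight_sym.
- exact: reduced_weight_diag.
Qed.

(** Inverse blocks of a matrix coupled through [w] are [invmx D] plus a multiple
    [kappa] of [psi psi^T] on [U], and the product of [psi] with a function of
    the outside across, where [psi] is the vector of row sums of [invmx D]. In
    the fused model the row sum is [tau / n], so that function is [n / tau]
    times the cross entries of [g], and [kappa] is obtained from its diagonal
    entry [tau / n ^ 2 + kappa * (tau / n) ^ 2]. *)
Definition reconstruct (g : {ffun reduced_vertex U * reduced_vertex U -> R})
    (tau : R) (Di : 'M[R]_n) : {ffun V * V -> R} :=
  let psi j := \sum_k Di j k in
  [ffun p => match vertex_pos p.1, vertex_pos p.2 with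
    | inl k, inl l => g (reduced_of (inl k), reduced_of (inl l))
    | inl k, inr j | inr j, inl k => g (reduced_of (inl k), None) * (n%:R * psi j / tau)
    | inr i, inr j =>
        Di i j + (n%:R ^+ 2 * g (None, None) - tau) / tau ^+ 2 * (psi i * psi j)
    end].

Section green.
Variables (s : a.-tuple mR) (t : n.-tuple mR).
Hypotheses (pD : posdef_mx (D t)) (pM : posdef_mx (block_potential vertex_of W s t)).
Let beta := merge vertex_pos s t.
Let beta' := merge reduced_pos s [tuple fused_potential t].
Let pS : posdef_mx (remainder w (P s) (green_weight t)).
Proof. by move: pM; rewrite block_full => /(coupled_posdef w (P s) _ (Dsym t) pD). Qed.
Let t0 := green_weight_gt0 pD.
Let Si := invmx (remainder w (P s) (green_weight t)).
Let psi j := \sum_k invmx (D t) j k.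
Let wSi := w *m Si.

Let psiE j : (invmx (D t) *m (const_mx 1 : 'rV[R]_n)^T) j 0 = psi j.
Proof. by rewrite mxE; apply: eq_bigr => k _; rewrite !mxE mulr1. Qed.

Let psi_sum : \sum_j psi j = green_weight t.
Proof.
rewrite /green_weight /quad -mulmxA mxE; apply: eq_bigr => j _.
by rewrite mxE mul1r psiE.
Qed.

Let greenE i j : green W beta (i, j) =
  match vertex_pos i, vertex_pos j with
  | inl k, inl l => Si k l
  | inl k, inr l | inr l, inl k => psi l * wSi 0 k
  | inr k, inr l => invmx (D t) k l + quad Si w * (psi k * psi l)
  end.
Proof.
rewrite (green_coupled vertex_ofK vertex_posK _ _ (Psym s) (Dsym t) pD (block_full s t) pS)//.
by case: (vertex_pos i) (vertex_pos j) => [k|k] [l|l]; rewrite ?psiE.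
Qed.

Let reducedE i j : green W' beta' (i, j) =
  match reduced_pos i, reduced_pos j with
  | inl k, inl l => Si k l
  | inl k, inr l | inr l, inl k => green_weight t / n%:R * wSi 0 k
  | inr k, inr l => green_weight t / n%:R ^+ 2 +
      quad Si w * (green_weight t / n%:R) ^+ 2
  end.
Proof.
rewrite (green_coupled reduced_ofK reduced_posK reduced_weight_sym reduced_weight_diag
  (Psym s) (tr_scalar_mx _ _) (reduced_posdef pD) (block_reduced s _)) reduced_quad//.
have pE (l : 'I_1) : (invmx ((2 * fused_potential t)%:M : 'M[R]_1) *m
    (const_mx n%:R : 'rV[R]_1)^T) l 0 = green_weight t / n%:R.
  rewrite fusedE invmx_scalar mul_scalar_mx !mxE.
  by field; rewrite !gt_eqF.
case: (reduced_pos i) (reduced_pos j) => [k|k] [l|l]; rewrite ?pE -?expr2//.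
congr (_ + _); rewrite fusedE invmx_scalar !ord1 mxE eqxx mulr1n.
by field; rewrite !gt_eqF.
Qed.

(** Averages over [U] see [psi] only through its sum [tau]. *)
Lemma coarse_graining_green : coarse_graining U (green W beta) = green W' beta'.
Proof.
have posU (j : 'I_n) : vertex_pos (enum_val j) = inr j by exact: (vertex_ofK (inr j)).
have posT (k : T) : vertex_pos (val k) = inl (enum_rank k).
  by rewrite -[k in LHS]enum_rankK; exact: (vertex_ofK (inl (enum_rank k))).
have cross (k : T) : n%:R^-1 * (\sum_(i in U) green W beta (val k, i)) =
    green_weight t / n%:R * wSi 0 (enum_rank k).
  rewrite big_enum_val/= -psi_sum mulr_suml mulr_suml mulr_sumr.
  by apply: eq_bigr => j _; rewrite greenE posU posT; ring.
apply/ffunP => -[[k|] [l|]]; rewrite ffunE reducedE/= ?cross//.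
  by rewrite greenE !posT.
rewrite big_enum_val/=.
under eq_bigr do rewrite big_enum_val/=.
under eq_bigr do under eq_bigr do rewrite greenE !posU.
under eq_bigr do rewrite big_split/= -/(psi _) -!mulr_sumr psi_sum.
rewrite big_split/= psi_sum -mulr_sumr -mulr_suml psi_sum.
by field; rewrite gt_eqF.
Qed.

Lemma reconstruct_green :
  reconstruct (green W' beta') (green_weight t) (invmx (D t)) = green W beta.
Proof.
apply/ffunP => -[i j]; rewrite greenE ffunE/=.
case: (vertex_pos i) (vertex_pos j) => [k|k] [l|l];
  rewrite ?reducedE /= ?enum_valK// -/(psi _) -/(psi _);
  by field; rewrite !gt_eqF.
Qed.

End green.

Lemma potential_density_full_neq0 s t :
  potential_density W (merge vertex_pos s t) != 0 ->
  posdef_mx (D t) /\ posdef_mx (block_potential vertex_of W s t).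
Proof.
rewrite (potential_density_merge vertex_ofK vertex_posK)// /potential_mx_density.
have [pM _|pM] := pselect (posdef_mx (block_potential vertex_of W s t)).
  by split=> //; exact: posdef_mx_ulsubmx pM.
by rewrite asboolF// eqxx.
Qed.

(** The Green matrix gives back the potential of the fused vertex. *)
Lemma potential_density_reduced_neq0 s b :
  potential_density W' (merge reduced_pos s [tuple b : mR]) != 0 ->
  0 < b /\
  invmx (mx_along (block_ver reduced_of)
      (fun i j => green W' (merge reduced_pos s [tuple b : mR]) (i, j)))
    (lshift a ord0) (lshift a ord0) = 2 * b.
Proof.
rewrite (potential_density_merge reduced_ofK reduced_posK reduced_weight_sym
  reduced_weight_diag) /potential_mx_density.
have [pM _|pM] := pselect (posdef_mx (block_potential reduced_of W' s [tuple b : mR])); last first.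
  by rewrite asboolF// eqxx.
split.
  move: pM; rewrite block_reduced => /posdef_mx_ulsubmx/posdef_mx_scalar.
  by rewrite pmulr_rgt0.
rewrite (_ : mx_along _ _ = invmx (block_potential reduced_of W' s [tuple b : mR])).
  by rewrite invmxK block_reduced block_mxEul mxE eqxx mulr1n.
apply/matrixP => i j; rewrite mxE.
rewrite (green_merge reduced_ofK reduced_posK reduced_weight_sym reduced_weight_diag)//.
by rewrite !(block_verK reduced_ofK).
Qed.

Lemma reconstruct_outer g tau Di (k l : T) :
  reconstruct g tau Di (val k, val l) = g (Some k, Some l).
Proof.
have posT (k' : T) : vertex_pos (val k') = inl (enum_rank k').
  by rewrite -[k' in LHS]enum_rankK; exact: (vertex_ofK (inl (enum_rank k'))).
by rewrite ffunE/= !posT/= !enum_rankK.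
Qed.

End fusion.

(** * The joint law of the Green matrix and its coarse-graining *)

Section measurability.
Variables (R : realType).
Local Notation mR := (measurableTypeR R).

Lemma measurable_Hmat (I : finType) (W : I -> I -> R) :
  measurable_mx (fun beta : {ffun I -> R} => mx_of (Hmat W beta)).
Proof.
move=> i j; under eq_fun do rewrite mxE /Hmat.
have [_|_] := boolP (enum_val i == enum_val j); last exact: measurable_cst.
by apply: measurable_funM; [exact: measurable_cst|exact: measurable_ffun_eval].
Qed.

Lemma measurable_green (I : finType) (W : I -> I -> R) :
  measurable_fun setT (green W).
Proof.
apply: measurable_ffunP => p; under eq_fun do rewrite ffunE.
exact: (measurable_invmx (measurable_Hmat W)).
Qed.

Lemma potential_densityE (I : finType) (W : I -> I -> R) beta :
  potential_density W beta = potential_mx_density (mx_of (Hmat W beta)).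
Proof.
rewrite /potential_density /potential_mx_density.
have AE : mx_along enum_val (Hmat W beta) = mx_of (Hmat W beta) by [].
rewrite -AE (asbool_equiv_eq (posdef_along (@enum_valK I) (@enum_rankK I) _)).
by rewrite (mx_total_along (@enum_valK I) (@enum_rankK I)).
Qed.

Lemma potential_density_ge0 (I : finType) (W : I -> I -> R) beta :
  0 <= potential_density W beta.
Proof. by rewrite potential_densityE potential_mx_density_ge0. Qed.

Lemma measurable_potential_density (I : finType) (W : I -> I -> R) :
  (forall i j, W i j = W j i) -> measurable_fun setT (potential_density W).
Proof.
move=> Wsym; rewrite (_ : potential_density W =
    fun beta => potential_mx_density (mx_of (Hmat W beta))); last first.
  by apply/funext => beta; rewrite potential_densityE.
apply: measurable_potential_mx_density; first exact: measurable_Hmat.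
move=> beta; apply/matrixP => i j; rewrite !mxE /Hmat eq_sym Wsym.
by case: eqP => [->|].
Qed.

Lemma measurable_coarse_graining (V : finType) (U : {set V}) :
  measurable_fun setT (@coarse_graining R V U).
Proof.
have msum (D : V -> {ffun V * V -> R} -> R) :
    (forall i, measurable_fun setT (D i)) ->
    measurable_fun setT (fun G => \sum_(i in U) D i G).
  move=> mD; under eq_fun do rewrite big_mkcond/=.
  by apply: measurable_sum => i; case: (i \in U) => //; exact: measurable_cst.
apply: measurable_ffunP => -[[k|] [l|]]; under eq_fun do rewrite ffunE.
- exact: measurable_ffun_eval.
- apply: measurable_funM; first exact: measurable_cst.
  by apply: msum => i; exact: measurable_ffun_eval.
- apply: measurable_funM; first exact: measurable_cst.
  by apply: msum => i; exact: measurable_ffun_eval.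
- apply: measurable_funM; first exact: measurable_cst.
  apply: (msum (fun i G => \sum_(j in U) G (i, j))) => i.
  by apply: (msum (fun j G => G (i, j))) => j; exact: measurable_ffun_eval.
Qed.

Lemma measurable_reconstruct d (S : measurableType d) (V : finType) (U : {set V})
    (i0 : V) (i0U : i0 \in U)
    (g : S -> {ffun reduced_vertex U * reduced_vertex U -> R}) (tau : S -> R)
    (Di : S -> 'M[R]_#|U|) :
  measurable_fun setT g -> measurable_fun setT tau -> measurable_mx Di ->
  measurable_fun setT (fun y => reconstruct i0U (g y) (tau y) (Di y)).
Proof.
move=> mg mt mD; apply: measurable_ffunP => p; under eq_fun do rewrite ffunE.
have mgp q : measurable_fun setT (fun y => g y q).
  exact: measurableT_comp (measurable_ffun_eval q) mg.
have mpsi j : measurable_fun setT (fun y => \sum_k Di y j k).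
  by apply: measurable_sum => k; exact: mD.
have mpsit j : measurable_fun setT (fun y => #|U|%:R * (\sum_k Di y j k) / tau y).
  by apply: measurable_fun_div => //; apply: measurable_funM; first exact: measurable_cst.
case: (vertex_pos i0U p.1) (vertex_pos i0U p.2) => [k|k] [l|l].
- exact: mgp.
- exact: measurable_funM.
- exact: measurable_funM.
- apply: measurable_funD; first exact: mD.
  apply: measurable_funM; last exact: measurable_funM.
  apply: measurable_fun_div; last exact: measurable_funX.
  by apply: measurable_funB => //; exact: measurable_funM.
Qed.

End measurability.

Section pair_law.
Variables (R : realType) (V : finType) (W : V -> V -> R) (U : {set V}).
Hypotheses (hW : weighted_graph W) (hind : indistinguishable W U).
Variables (i0 : V) (i0U : i0 \in U).
Local Notation mR := (measurableTypeR R).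
Local Notation mu := (@lebesgue_measure R).
Local Notation T := {k : V | k \notin U}.
Local Notation a := #|{: T}|.
Local Notation n := #|U|.
Local Notation W' := (reduced_weight W U).
Local Notation reduced_green := {ffun reduced_vertex U * reduced_vertex U -> R}.

Definition inner_potential (t : n.-tuple mR) : 'M[R]_n :=
  pot_mx (inner_weight (@vertex_of V U) W) t.

Let n_gt0 : (0 < n)%N.
Proof. by rewrite card_gt0; apply/set0Pn; exists i0. Qed.

Let n0 : 0 < n%:R :> R. Proof. by rewrite ltr0n. Qed.

(** Twice the potential of the fused vertex, read off from its Green matrix. *)
Definition fused_diagonal (g : reduced_green) : R :=
  invmx (mx_along (block_ver (@reduced_of V U)) (fun i j => g (i, j)))
    (lshift a ord0) (lshift a ord0).

Lemma measurable_fused_diagonal : measurable_fun setT fused_diagonal.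
Proof.
apply: measurable_invmx => i j.
apply: (eq_measurable_fun (fun g : reduced_green =>
  g (block_ver (@reduced_of V U) i, block_ver (@reduced_of V U) j))).
  by move=> g _; rewrite [RHS]mxE.
exact: measurable_ffun_eval.
Qed.

Lemma inner_sampler :
  sampler_spec (fun _ : unit => inner_weight (@vertex_of V U) W)
    (fun _ : unit => const_mx 1).
Proof.
suff H m (M : 'M[R]_m) : (0 < m)%N -> M^T = M -> (forall i j, 0 <= M i j) ->
    sampler_spec (fun _ : unit => M) (fun _ : unit => const_mx 1).
  apply: H => // [|i j]; last by rewrite mxE weight_ge0.
  by apply/matrixP => i j; rewrite !mxE weight_sym.
case: m M => // m M _ Msym M0; apply: sampler; split => // _ j.
by rewrite mxE.
Qed.

(** The Green matrices of the reduced model and of its resampled extension are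
    jointly distributed as the coarse-graining and the Green matrix of the full
    model. For each potential [s] of the outside, both sides equal the integral
    of [levy n] against the same function [J] of [t]: the full model by
    [inner_sampler], the reduced one by the one-vertex case, where
    [t = n ^ 2 / 2 b]. *)
Theorem pair_law : exists (d : measure_display) (Xi : measurableType d)
    (Q : probability Xi R) (Phi : reduced_green * Xi -> {ffun V * V -> R}),
  [/\ measurable_fun setT Phi,
    forall g xi (k l : T), Phi (g, xi) (val k, val l) = g (Some k, Some l) &
    forall F : reduced_green * {ffun V * V -> R} -> \bar R,
      measurable_fun setT F -> (forall p, 0 <= F p)%E ->
      (\int[@lebesgue_ffun R (reduced_vertex U)]_beta
        ((potential_density W' beta)%:E *
         \int[Q]_xi F (green W' beta, Phi (green W' beta, xi))) =
      \int[@lebesgue_ffun R V]_beta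
        ((potential_density W beta)%:E *
         F (coarse_graining U (green W beta), green W beta)))%E].
Proof.
have [d [Xi [Q [S [mS SE]]]]] := inner_sampler.
pose tau (x : R) : mR := n%:R ^+ 2 / x.
pose body (g : reduced_green) (t : mR) (xi : Xi) :=
  reconstruct i0U g t (invmx (inner_potential (S ((tt, t), xi)))).
pose Phi (p : reduced_green * Xi) := body p.1 (tau (fused_diagonal p.1)) p.2.
have mbody d2 (Y : measurableType d2) (g : Y -> reduced_green) (t : Y -> mR)
    (xi : Y -> Xi) : measurable_fun setT g -> measurable_fun setT t ->
    measurable_fun setT xi -> measurable_fun setT (fun y => body (g y) (t y) (xi y)).
  move=> mg mt mxi; apply: measurable_reconstruct => //.
  apply: measurable_invmx; apply: measurable_pot_mx.
    by move=> i j; exact: measurable_cst.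
  apply: (measurableT_comp mS); apply: measurable_fun_pair => //.
  by apply: measurable_fun_pair => //; exact: measurable_cst.
have mtau d2 (Y : measurableType d2) (x : Y -> R) : measurable_fun setT x ->
    measurable_fun setT (fun y => tau (x y)).
  by move=> mx; apply: measurable_fun_div => //; exact: measurable_cst.
have mPhi : measurable_fun setT Phi.
  apply: mbody => //; apply: mtau.
  exact: measurableT_comp measurable_fused_diagonal measurable_fst.
exists d, Xi, Q, Phi; split=> // [g xi k l|F mF F0].
  exact: reconstruct_outer.
have Wsym := weight_sym hW.
have mF1 : measurable_fun setT (fun g : reduced_green =>
    \int[Q]_xi F (g, Phi (g, xi)))%E.
  have mF2 : measurable_fun setT (fun p : reduced_green * Xi => F (p.1, Phi p)).
    by apply: (measurableT_comp mF); exact: measurable_fun_pair.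
  by apply: (measurable_fun_fubini_tonelli_F _ mF2) => p; exact: F0.
have F10 g : (0 <= \int[Q]_xi F (g, Phi (g, xi)))%E by exact: integral_ge0.
rewrite (ge0_integral_lebesgue_ffun (Bijective (@reduced_posK V U) (@reduced_ofK V U))); last 2 first.
- apply: emeasurable_funM.
    apply/measurable_EFinP; apply: measurable_potential_density.
    exact: reduced_weight_sym.
  exact: measurableT_comp mF1 (measurable_green W').
- by move=> b; rewrite mule_ge0// lee_fin potential_density_ge0.
rewrite [RHS](ge0_integral_lebesgue_ffun (Bijective (vertex_posK i0U) (vertex_ofK i0U))); last 2 first.
- apply: emeasurable_funM.
    by apply/measurable_EFinP; exact: measurable_potential_density.
  apply: (measurableT_comp mF); apply: measurable_fun_pair.
    exact: measurableT_comp (@measurable_coarse_graining R V U) (measurable_green W).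
  exact: measurable_green.
- by move=> b; rewrite mule_ge0// lee_fin potential_density_ge0.
apply: eq_integral => s _.
pose gam (b : mR) := merge (@reduced_pos V U) s [tuple b].
(* The potential of the fused vertex as a function of [t]; [ratio] is the
   factor that [density_exchange] leaves next to the density of the block. *)
pose half_tau (t : mR) : mR := 2^-1 * (n%:R ^+ 2 / t).
pose ratio (t : mR) := potential_density W' (gam (half_tau t)) /
  potential_mx_density ((2 * half_tau t)%:M : 'M[R]_1).
pose g' (t : mR) := green W' (gam (half_tau t)).
pose Psi (p : mR * n.-tuple mR) := ((ratio p.1)%:E *
  F (g' p.1, reconstruct i0U (g' p.1) p.1 (invmx (inner_potential p.2))))%E.
have mgam : measurable_fun setT gam.
  apply: measurable_ffunP => i; under eq_fun do rewrite ffunE.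
  case: (reduced_pos i) => j; first exact: measurable_cst.
  by rewrite (ord1 j); exact: measurable_id.
have mhalf : measurable_fun setT half_tau.
  by rewrite /half_tau; repeat measurability_step.
have mgamh := measurableT_comp mgam mhalf.
have mratio : measurable_fun setT ratio.
  apply: measurable_fun_div.
    exact: measurableT_comp (measurable_potential_density (reduced_weight_sym hW)) mgamh.
  apply: measurable_potential_mx_density => [i j|t]; last by rewrite tr_scalar_mx.
  rewrite (ord1 i) (ord1 j); under eq_fun do rewrite mxE eqxx mulr1n.
  by apply: measurable_funM => //; exact: measurable_cst.
have mg' : measurable_fun setT g'.
  exact: measurableT_comp (measurable_green W') mgamh.
have mPsi : measurable_fun setT Psi.
  apply: emeasurable_funM.
    by apply/measurable_EFinP; exact: measurableT_comp mratio measurable_fst.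
  have mg'1 := measurableT_comp mg' (measurable_fst : measurable_fun setT
    (fst : mR * n.-tuple mR -> mR)).
  apply: (measurableT_comp mF); apply: measurable_fun_pair => //.
  apply: measurable_reconstruct => //.
  by apply: measurable_invmx; apply: measurable_pot_mx.
have ratio0 t : 0 <= ratio t.
  by rewrite divr_ge0 ?potential_density_ge0 ?potential_mx_density_ge0.
have Psi0 p : (0 <= Psi p)%E by rewrite mule_ge0// lee_fin.
pose J (t : mR) := (\int[Q]_xi Psi (t, S ((tt, t), xi)))%E.
have mJ : measurable_fun setT J.
  have mJ' : measurable_fun setT (fun p : mR * Xi => Psi (p.1, S ((tt, p.1), p.2))).
    apply: (measurableT_comp mPsi); apply: measurable_fun_pair => //.
    apply: (measurableT_comp mS); apply: measurable_fun_pair => //.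
    by apply: measurable_fun_pair => //; exact: measurable_cst.
  exact: (measurable_fun_fubini_tonelli_F _ mJ').
have J0 t : (0 <= J t)%E by exact: integral_ge0.
transitivity (\int[mu]_t ((levy n%:R t)%:E * J t))%E; last first.
  have -> : n%:R = \sum_j (const_mx 1 : 'rV[R]_n) 0 j.
    by under eq_bigr do rewrite mxE; rewrite sumr_const card_ord.
  rewrite -[LHS](SE tt Psi mPsi Psi0); apply: eq_integral => t _.
  rewrite -/(merge (vertex_pos i0U) s t) -[quad _ _]/(green_weight W t).
  rewrite -[pot_mx _ _]/(inner_potential t).
  have [pD|pD] := pselect (posdef_mx (inner_potential t)); last first.
    rewrite {1}/potential_mx_density (asboolF pD) mul0e.
    have [->|/(potential_density_full_neq0 hW)[]//] :=
      eqVneq (potential_density W (merge (vertex_pos i0U) s t)) 0.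
    by rewrite mul0e.
  have E := density_exchange hW hind i0U s pD.
  have p2 : 0 < potential_mx_density ((2 * half_tau (green_weight W t))%:M : 'M[R]_1).
    apply: potential_mx_density_gt0; first exact: tr_scalar_mx.
    apply/posdef_mx_scalar; rewrite mulr_gt0// mulr_gt0// divr_gt0 ?exprn_gt0//.
    exact: (green_weight_gt0 hW i0U pD).
  rewrite /Psi muleA -EFinM /ratio/= mulrA.
  rewrite -[potential_density W' _]/(potential_density W'
    (merge (@reduced_pos V U) s [tuple fused_potential W t])) -E mulfK ?gt_eqF//.
  have [->|dW] := eqVneq (potential_density W (merge (vertex_pos i0U) s t)) 0.
    by rewrite !mul0e.
  have [_ pM] := potential_density_full_neq0 hW dW.
  rewrite (coarse_graining_green hW hind i0U pD pM).
  by rewrite -(reconstruct_green hW hind i0U pD pM).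
have [||//|d1 [Xi1 [Q1 [S1 [_ S1E]]]]] := @sampler1 R _ unit
  (fun _ => 0) (fun _ => const_mx n%:R).
- by move=> i j; exact: measurable_cst.
- by move=> i j; exact: measurable_cst.
- by move=> _ j; rewrite mxE.
have -> : n%:R = \sum_j (const_mx n%:R : 'rV[R]_1) 0 j.
  by rewrite big_ord1 mxE.
transitivity (\int[lebesgue_tuple R 1]_b
  ((potential_mx_density (pot_mx 0 b))%:E * J (quad (invmx (pot_mx 0 b)) (const_mx n%:R))))%E.
  apply: eq_integral => b _.
  case/tupleP: b => x b; rewrite (tuple0 b) {b}.
  rewrite -/(merge (@reduced_pos V U) s [tuple x]).
  have -> : pot_mx 0 [tuple x] = (2 * x)%:M :> 'M[R]_1.
    by apply/matrixP => i j; rewrite !mxE !ord1/= subr0 mulr1n.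
  have qE : quad (invmx ((2 * x)%:M : 'M[R]_1)) (const_mx n%:R) = tau (2 * x).
    rewrite invmx_scalar /quad mul_mx_scalar -scalemxAl mxE mxE big_ord1 !mxE.
    by rewrite mulrC.
  rewrite qE; have [x0|x0] := ltP 0 x; last first.
    rewrite {1}/potential_mx_density asboolF ?mul0e; last first.
      by move=> /posdef_mx_scalar; rewrite pmulr_rgt0// ltNge x0.
    have [->|dW] := eqVneq (potential_density W' (merge (@reduced_pos V U) s [tuple x])) 0.
      by rewrite mul0e.
    by have [] := potential_density_reduced_neq0 hW hind i0U dW; rewrite ltNge x0.
  have hE : half_tau (tau (2 * x)) = x by rewrite /half_tau /tau; field; rewrite !gt_eqF.
  have p2 : 0 < potential_mx_density ((2 * x)%:M : 'M[R]_1).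
    apply: potential_mx_density_gt0; first exact: tr_scalar_mx.
    by apply/posdef_mx_scalar; rewrite mulr_gt0.
  rewrite /J /Psi/= /g' /ratio hE.
  rewrite ge0_integralZl_EFin//; last 2 first.
  - apply: (measurableT_comp mF); apply: measurable_fun_pair => //.
    by apply: mbody => //; exact: measurable_cst.
  - by rewrite divr_ge0 ?potential_density_ge0 ?potential_mx_density_ge0.
  rewrite muleA -EFinM mulrCA mulfV; last by rewrite gt_eqF.
  rewrite mulr1 -/(gam x).
  have [->|dW] := eqVneq (potential_density W' (gam x)) 0; first by rewrite !mul0e.
  have [_ diagE] := potential_density_reduced_neq0 hW hind i0U dW.
  congr (_ * _)%E; apply: eq_integral => xi _.
  by rewrite /Phi /fused_diagonal/= diagE.
have mJ1 : measurable_fun setT (fun p : mR * 1.-tuple mR => J p.1).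
  exact: measurableT_comp mJ measurable_fst.
rewrite [LHS](S1E tt (fun p => J p.1) mJ1)//.
apply: eq_integral => t _; congr (_ * _)%E.
by rewrite /= integral_cst//= probability_setT mule1.
Qed.

End pair_law.

Theorem theorem7 (R : realType) (V : finType) (W : V -> V -> R) (U : {set V})
    (hW : weighted_graph W) (hU : exists i, i \in U)
    (hind : indistinguishable W U)
    (d : measure_display) (Omega : measurableType d) (P : probability Omega R)
    (G' : Omega -> {ffun reduced_vertex U * reduced_vertex U -> R})
    (hG' : has_law P G' (green_law (reduced_weight W U))) :
  exists (d1 : measure_display) (Omega1 : measurableType d1)
         (P1 : probability Omega1 R) (p : Omega1 -> Omega)
         (d2 : measure_display) (Xi : measurableType d2) (xi : Omega1 -> Xi)
         (Phi : {ffun reduced_vertex U * reduced_vertex U -> R} * Xi ->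
                {ffun V * V -> R}),
    let G := fun w : Omega1 => Phi (G' (p w), xi w) in
    space_extension P P1 p /\
    measurable_fun setT xi /\
    independent_rv P1 xi (G' \o p) /\
    measurable_fun setT Phi /\
    has_law P1 G (green_law W) /\
    {ae P1, forall w, coarse_graining U (G w) = G' (p w)} /\
    (forall (w : Omega1) (k l : {k : V | k \notin U}),
       G w (val k, val l) = G' (p w) (Some k, Some l)).
Proof.
have [i0 i0U] := hU.
have [d' [Xi [Q [Phi [mPhi outer law]]]]] := pair_law hW hind i0U.
have [mG' G'law] := hG'.
pose P1 : probability (Omega * Xi)%type R := (P \x Q)%E.
exists _, (Omega * Xi)%type, P1, fst, d', Xi, snd, Phi => G.
have rect A B : measurable A -> measurable B -> P1 (A `*` B) = (P A * Q B)%E.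
  by move=> mA mB; exact: product_measure1E.
have fstE A : (fst : Omega * Xi -> Omega) @^-1` A = A `*` [set: Xi].
  by apply/seteqP; split => [[x y] //= Ax|[x y] []].
have sndE A : (snd : Omega * Xi -> Xi) @^-1` A = [set: Omega] `*` A.
  by apply/seteqP; split => [[x y] //= Ay|[x y] []].
have mG : measurable_fun setT G.
  apply: (measurableT_comp mPhi); apply: measurable_fun_pair => //.
  exact: measurableT_comp mG' measurable_fst.
have mpre e (Y : measurableType e) (f : Omega -> Y) A :
    measurable_fun setT f -> measurable A -> measurable (f @^-1` A).
  by move=> mf mA; rewrite -[X in measurable X]setTI; exact: mf.
have W'sym := reduced_weight_sym (U := U) hW.
(* Fubini over the noise, then the law of [G'], bring the statement to
   [pair_law]. *)
have joint F : measurable_fun setT F -> (forall q, 0 <= F q)%E ->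
    (\int[P1]_w F (G' w.1, G w) =
     \int[@lebesgue_ffun R V]_beta ((potential_density W beta)%:E *
       F (coarse_graining U (green W beta), green W beta)))%E.
  move=> mF F0; rewrite -law//.
  have mF2 : measurable_fun setT (fun q => F (q.1, Phi q)).
    by apply: (measurableT_comp mF); exact: measurable_fun_pair.
  have mF3 : measurable_fun setT (fun w : Omega * Xi => F (G' w.1, G w)).
    apply: (measurableT_comp mF); apply: measurable_fun_pair => //.
    exact: measurableT_comp mG' measurable_fst.
  rewrite [LHS](fubini_tonelli1 _ mF3)//.
  apply: (@ge0_integral_transfer _ _ _ _ _ _ _ P _ G' (green (reduced_weight W U))
    (potential_density (reduced_weight W U)) mG' (measurable_green _)
    (measurable_potential_density W'sym) (potential_density_ge0 _) G'law
    (fun g => \int[Q]_x F (g, Phi (g, x)))%E).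
    exact: (measurable_fun_fubini_tonelli_F _ mF2).
  by move=> g; apply: integral_ge0.
split; [split; [exact: measurable_fst|] | split; [exact: measurable_snd|]].
  move=> A mA; rewrite /pushforward.
  by rewrite fstE rect// probability_setT mule1.
split.
  move=> A B mA mB; have mB' := mpre _ _ _ _ mG' mB.
  rewrite comp_preimage fstE sndE.
  by rewrite -setXI setTI setIT !rect// !probability_setT mule1 mul1e muleC.
have joint_measure D : measurable D -> P1 ((fun w => (G' w.1, G w)) @^-1` D) =
    (\int[@lebesgue_ffun R V]_beta ((potential_density W beta)%:E *
       (\1_D (coarse_graining U (green W beta), green W beta))%:E))%E.
  move=> mD; rewrite -(joint (fun q => (\1_D q)%:E))//; last first.
    by apply/measurable_EFinP; exact: measurable_indic.
  rewrite -[RHS]/(\int[P1]_w (\1_((fun w => (G' w.1, G w)) @^-1` D) w)%:E)%E.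
  rewrite integral_indic ?setIT//.
  rewrite -[X in measurable X]setTI; apply: (measurable_fun_pair _ mG) => //.
  exact: measurableT_comp mG' measurable_fst.
split=> //; split; first split=> //.
  move=> A mA; rewrite /pushforward.
  have := joint_measure ([set: _] `*` A) (measurableX measurableT mA).
  have -> : (fun w => (G' w.1, G w)) @^-1` ([set: _] `*` A) = G @^-1` A.
    by apply/seteqP; split => [w []|w].
  move=> ->; rewrite /green_law /pushforward /potential_law [RHS]integral_mkcond.
  apply: eq_integral => beta _; rewrite patchE indicE in_setX in_setT/=.
  rewrite -[beta \in _]/(green W beta \in A); case: ifPn => _; first by rewrite mule1.
  by rewrite mule0.
split; last by move=> w k l; exact: outer.
(* A single measurable function that vanishes exactly where the
   coarse-graining is as wanted. *)
pose err (q : {ffun reduced_vertex U * reduced_vertex U -> R} * {ffun V * V -> R}) :=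
  \sum_i (coarse_graining U q.2 i - q.1 i) ^+ 2.
have merr : measurable_fun setT err.
  apply: measurable_sum => i; apply: measurable_funX; apply: measurable_funB.
    have mC := measurableT_comp (@measurable_coarse_graining R V U) measurable_snd.
    exact: measurableT_comp (measurable_ffun_eval i) (mC _ _).
  exact: measurableT_comp (measurable_ffun_eval i) measurable_fst.
have merrN : measurable (err @^-1` (~` [set 0])).
  rewrite -[X in measurable X]setTI; apply: merr => //.
  by apply: measurableC; exact: measurable_set1.
exists ((fun w => (G' w.1, G w)) @^-1` (err @^-1` (~` [set 0]))); split.
- rewrite -[X in measurable X]setTI; apply: (measurable_fun_pair _ mG) => //.
  exact: measurableT_comp mG' measurable_fst.
- rewrite joint_measure//.
  rewrite integral0_eq// => beta _; rewrite indicE memNset ?mule0// /err/=.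
  by move=> []; apply: big1 => i _; rewrite subrr expr0n.
- move=> w /= CGw err0; apply: CGw; apply/ffunP => i; apply/eqP.
  rewrite -subr_eq0 -sqrf_eq0; apply/eqP.
  by apply: (psumr_eq0P _ err0) => // j _; exact: sqr_ge0.
Qed.
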